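(* Let $\gamma\in(0,1)$, $a=1-2\gamma$, let $m\ge1$, and let $f\in C^{2,\alpha}\big((-1,1)\big)$, for some $\alpha\in(0,1)$, be odd with $f(0)=f(1)=0$ and $f''<0$ in $(0,1)$. Let $u$ be a saddle-shaped solution of $$\operatorname{div}(\lambda^a\nabla u)=0\ \text{ in }\mathbb{R}^{2m+1}_+,\qquad d_\gamma\frac{\partial u}{\partial\nu^a}=f(u)\ \text{ on }\partial\mathbb{R}^{2m+1}_+=\mathbb{R}^{2m}.$$ Let $\Omega\subset\mathcal{O}\times(0,+\infty)\subset\mathbb{R}^{2m+1}_+$ be an open set such that $\partial_0\Omega$ is nonempty. Let $v\in C^2(\Omega)\cap C(\overline{\Omega})$ be bounded from above and such that $\lambda^a v_\lambda\in C(\overline\Omega)$. Define $$\mathscr{L}_u v:=d_\gamma\frac{\partial v}{\partial\nu^a}-f'(u)\,v\quad\text{on }\partial_0\Omega\subset\mathbb{R}^{2m}\times\{0\},$$ and assume that, for some function $b=b(x,\lambda)\le0$ on $\Omega$, $$\begin{cases}-\operatorname{div}(\lambda^a\nabla v)\le b(x,\lambda)\,v & \text{in }\Omega,\\ \mathscr{L}_uv\le0 & \text{on }\partial_0\Omega,\\ v\le0 & \text{on }\partial_L\Omega,\\ \displaystyle\limsup_{x\in\partial_0\Omega,\ |x|\to+\infty}v(x,0)\le0.\end{cases}$$ Then $v\le0$ in $\Omega$.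
   Context: Notation. $\mathbb{R}^{n+1}_+=\mathbb{R}^n\times(0,+\infty)$ with points $(x,\lambda)$; $\nabla$ and $\operatorname{div}$ are taken in $(x,\lambda)$. $\dfrac{\partial u}{\partial\nu^a}(x):=-\lim_{\lambda\downarrow0}\lambda^a u_\lambda(x,\lambda)$. The constant $d_\gamma>0$ depends only on $\gamma$ and is the one for which $(-\Delta)^\gamma u(\cdot,0)=d_\gamma\,\partial u/\partial\nu^a$ whenever $\operatorname{div}(\lambda^a\nabla u)=0$ in $\mathbb{R}^{n+1}_+$. The same letter denotes a function on $\mathbb{R}^{n+1}_+$ and its trace on $\mathbb{R}^n=\{\lambda=0\}$. For $\Omega\subset\mathbb{R}^{n+1}_+$: $\partial_L\Omega:=\overline{\partial\Omega\cap\{\lambda>0\}}$ and $\partial_0\Omega:=\partial\Omega\setminus\partial_L\Omega\subset\{\lambda=0\}$. The space $C^{2,\alpha}((-1,1))$ has finite norm, so $f,f',f''$ extend continuously to $[-1,1]$. In $\mathbb{R}^{2m}$ write $x=(x',x'')\in\mathbb{R}^m\times\mathbb{R}^m$, $s=|x'|$, $t=|x''|$, $\mathcal{O}=\{s>t\}$; the Simons cone is $\mathscr{C}=\{s=t\}$. A saddle-shaped solution is a bounded (classical) solution $u$, with $|u|<1$, such that: (i) $u$ is doubly radial, i.e. $u=u(s,t,\lambda)$; (ii) $u$ is odd with respect to $\mathscr{C}$, i.e. $u(s,t,\lambda)=-u(t,s,\lambda)$; (iii) $u>0$ in $\mathcal{O}\times[0,+\infty)$. *)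

(* Defs.v *)
From mathcomp Require Import all_boot all_order all_algebra.
From mathcomp Require Import all_classical all_reals all_analysis.
Set Implicit Arguments.
Unset Strict Implicit.
Unset Printing Implicit Defensive.
Import Order.TTheory GRing.Theory Num.Theory.
Import numFieldNormedType.Exports.
Local Open Scope classical_set_scope.
Local Open Scope ring_scope.

(* The library norm on ['rV[R]_n] is the sup norm. *)
Definition enorm (R : realType) (n : nat) (x : 'rV[R]_n) : R :=
  Num.sqrt (\sum_(i < n) x 0 i ^+ 2).

(* Quantifying over all directions instead of the coordinate ones gives the
   same class and keeps the definition basis-free. *)
Definition C2 (R : realType) (V : normedModType R) (D : set V) (w : V -> R) :
    Prop :=
  forall p, D p ->
    [/\ {for p, continuous w},
        forall e1 : V, derivable w p e1 /\ {for p, continuous ('D_e1 w)}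
      & forall e1 e2 : V,
          derivable ('D_e1 w) p e2 /\ {for p, continuous ('D_e2 ('D_e1 w))}].

(* A finite C^{2,alpha} norm on the open interval (-1,1); nothing is said about
   the values of [f] elsewhere. *)
Definition C2alpha (R : realType) (alpha : R) (f : R -> R) : Prop :=
  (forall x, x \in `]-1, 1[ ->
     derivable f x 1 /\ derivable (derive1 f) x 1) /\
  exists K : R,
    (forall x, x \in `]-1, 1[ ->
       [/\ `|f x| <= K, `|derive1 f x| <= K & `|derive1n 2 f x| <= K]) /\
    (forall x y, x \in `]-1, 1[ -> y \in `]-1, 1[ ->
       `|derive1n 2 f x - derive1n 2 f y| <= K * `|x - y| `^ alpha).

Definition halfspace (R : realType) (n : nat) : set ('rV[R]_n * R) :=
  [set p | 0 < p.2].

Definition bd (T : topologicalType) (A : set T) : set T :=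
  closure A `\` interior A.

Definition bdL (R : realType) (n : nat) (A : set ('rV[R]_n * R)) :
    set ('rV[R]_n * R) :=
  closure (bd A `&` [set p | 0 < p.2]).

Definition bd0 (R : realType) (n : nat) (A : set ('rV[R]_n * R)) :
    set ('rV[R]_n * R) :=
  bd A `\` bdL A.

Definition dx (R : realType) (n : nat) (i : 'I_n) (w : 'rV[R]_n * R -> R) :
    'rV[R]_n * R -> R :=
  'D_((delta_mx 0 i, 0) : 'rV[R]_n * R) w.

Definition dlam (R : realType) (n : nat) (w : 'rV[R]_n * R -> R) :
    'rV[R]_n * R -> R :=
  'D_((0, 1) : 'rV[R]_n * R) w.

Definition div_weighted_grad (R : realType) (n : nat) (a : R)
    (w : 'rV[R]_n * R -> R) (p : 'rV[R]_n * R) : R :=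
  \sum_(i < n) dx i (fun q => q.2 `^ a * dx i w q) p
  + dlam (fun q => q.2 `^ a * dlam w q) p.

Definition conormal (R : realType) (n : nat) (a : R)
    (w : 'rV[R]_n * R -> R) (x : 'rV[R]_n) : R :=
  - lim ((fun l : R => l `^ a * dlam w (x, l)) @ (0 : R)^'+).

(* [w] in C^2(D) and C(closure D), with lambda^a w_lambda in C(closure D): the
   weighted derivative is only meaningful in [D], so the last condition asks
   for a continuous extension [g] to the closure. *)
Definition classical_reg (R : realType) (n : nat) (a : R)
    (D : set ('rV[R]_n * R)) (w : 'rV[R]_n * R -> R) : Prop :=
  [/\ C2 D w,
      {within closure D, continuous w}
    & exists g : 'rV[R]_n * R -> R,
        {within closure D, continuous g} /\
        forall p, D p -> g p = p.2 `^ a * dlam w p].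

(* Lebesgue integral over R^n, as an iterated integral. *)
Fixpoint integral_rV (R : realType) (n : nat) :
    ('rV[R]_n -> \bar R) -> \bar R :=
  match n return ('rV[R]_n -> \bar R) -> \bar R with
  | 0 => fun F => F 0
  | n'.+1 => fun F =>
      (\int[lebesgue_measure]_(t in [set: R])
         integral_rV (fun y : 'rV[R]_n' =>
           F (row_mx (t%:M : 'rV[R]_1) y)))%E
  end.

(* The normalization makes |xi|^(2 gamma) the Fourier symbol of the fractional
   Laplacian. *)
Definition frac_lap_cst (R : realType) (n : nat) (gamma : R) : R :=
  (fine (integral_rV (fun y : 'rV[R]_n.+1 =>
     ((1 - cos (y 0 ord0)) / enorm y `^ (n.+1%:R + 2 * gamma))%:E)))^-1.

(* Principal value of the singular integral. *)
Definition frac_lap (R : realType) (n : nat) (gamma : R)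
    (w : 'rV[R]_n.+1 -> R) (x : 'rV[R]_n.+1) : R :=
  frac_lap_cst n gamma *
  lim ((fun eps : R => fine (integral_rV (fun y : 'rV[R]_n.+1 =>
          (if eps < enorm y
           then (w x - w (x + y)) / enorm y `^ (n.+1%:R + 2 * gamma)
           else 0)%:E)))
       @ (0 : R)^'+).

(* [d] is d_gamma, the constant, independent of the dimension, that relates the
   fractional Laplacian to the conormal derivative of the extension. The
   extension is taken bounded (the function lambda^(2 gamma) shows that the
   identity fails otherwise) and its trace C^2, so that the principal value
   exists. *)
Definition extension_constant (R : realType) (gamma d : R) : Prop :=
  0 < d /\
  forall (n : nat) (w : 'rV[R]_n.+1 * R -> R),
    classical_reg (1 - 2 * gamma) (@halfspace R n.+1) w ->
    (exists K : R, forall x l, 0 <= l -> `|w (x, l)| <= K) ->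
    C2 [set: 'rV[R]_n.+1] (fun x => w (x, 0)) ->
    (forall p, halfspace p -> div_weighted_grad (1 - 2 * gamma) w p = 0) ->
    forall x, frac_lap gamma (fun y => w (y, 0)) x
              = d * conormal (1 - 2 * gamma) w x.

Definition srad (R : realType) (m : nat) (x : 'rV[R]_(m + m)) : R :=
  enorm (lsubmx x).

Definition trad (R : realType) (m : nat) (x : 'rV[R]_(m + m)) : R :=
  enorm (rsubmx x).

Definition calO (R : realType) (m : nat) : set 'rV[R]_(m + m) :=
  [set x | trad x < srad x].

Definition extension_solution (R : realType) (n : nat) (a d : R) (f : R -> R)
    (u : 'rV[R]_n * R -> R) : Prop :=
  [/\ classical_reg a (@halfspace R n) u,
      forall p, halfspace p -> div_weighted_grad a u p = 0
    & forall x, d * conormal a u x = f (u (x, 0))].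

Definition saddle_shaped_solution (R : realType) (m : nat) (a d : R)
    (f : R -> R) (u : 'rV[R]_(m + m) * R -> R) : Prop :=
  [/\ extension_solution a d f u,
      forall x l, 0 <= l -> `|u (x, l)| < 1,
      exists U : R -> R -> R -> R,
        (forall x l, 0 <= l -> u (x, l) = U (srad x) (trad x) l) /\
        (forall s t l, 0 <= s -> 0 <= t -> 0 <= l -> U s t l = - U t s l)
    & forall x l, calO x -> 0 <= l -> 0 < u (x, l)].

Definition linearized (R : realType) (n : nat) (a d : R) (f : R -> R)
    (u v : 'rV[R]_n * R -> R) (x : 'rV[R]_n) : R :=
  d * conormal a v x - derive1 f (u (x, 0)) * v (x, 0).

(* limsup of [w] along the points of [S] with |x| -> +oo; it is [-oo] when [S]
   is bounded in x. *)
Definition limsup_at_infty (R : realType) (n : nat) (S : set ('rV[R]_n * R))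
    (w : 'rV[R]_n * R -> R) : \bar R :=
  limf_esup (fun p => (w p)%:E)
    (filter_from [set: R] (fun r => [set p | S p /\ r < enorm p.1])).

(* Main.v *)
Require Import Defs.
From HB Require Import structures.
From mathcomp Require Import all_boot all_order all_algebra.
From mathcomp Require Import all_classical all_reals all_analysis.
From mathcomp Require Import ring lra.
Set Implicit Arguments.
Unset Strict Implicit.
Unset Printing Implicit Defensive.
Import Order.TTheory GRing.Theory Num.Theory.
Import numFieldNormedType.Exports.
Local Open Scope classical_set_scope.
Local Open Scope ring_scope.

(** Since [f] is concave, [f u > f' u * u], so [u] is a strict supersolution of
the linearized problem on [calO], but it degenerates where [u] is small. By
comparison with a product subsolution on large balls, [u] is bounded below away
from the cone. Near the cone one adds a small multiple of a bounded function
[collar_min], which is a positive supersolution there because the collar is thin: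
it is an increasing concave function of (s^2 - t^2) / |x|, which is superharmonic
in [calO] with gradient at least 1, times a decreasing-then-increasing profile in
lambda. The sum [psi] is bounded below by a positive constant. If [v] were positive
somewhere on the bottom, [v / psi] would attain its maximum [T] there, by the limsup
condition; [v <= T * psi] extends to [Omega] by a barrier that is proper on the
half-space, and comparing conormal derivatives at the maximum point contradicts
the strictness of [psi]. *)

(** * Weighted derivatives and maximum points *)

(** The shape of the collar is dictated by the bottom. There [f'(u)] is at most [mu = f'(0) > 0], so
    the profile begins as [1 - A * l ^ (2 * gamma)] with [d * (2 * gamma * A) = mu]: its conormal
    term then balances [mu] times the collar exactly, and strictness is left to the gap
    [f(u) - f'(u) * u]. Such a profile decreases, so a term [B * l ^ 2] must keep it above 3/4. The
    positive divergence of that term is paid for by concavity in the cone variable, whence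
    [j ^ 2 = 4 * B * (1 + a)] and a collar of width about [1 / j]. Cutting the collar off at a
    constant is free in the interior, but a constant has no conormal derivative: on the bottom it is
    admissible only where the gap is bounded below, and this is what the lower bound on [u] away
    from the cone provides. As [psi] contains a minimum, it is never differentiated; it is only
    touched from above by smooth functions. All comparisons then reduce to one-variable statements
    along coordinate lines through a contact point. *)

Section OneDimensional.
Context {R : realType}.
Implicit Types (w g f : R -> R) (t d c k : R).

(* [g' t = d] and [(w * g')' t = c]: with [w] constant this is a second derivative,
   with [w] a power it is the normal part of [div (lambda^a grad g)]. *)
Definition wder2 w g t d c : Prop := exists g1 : R -> R,
  [/\ \forall s \near t, is_derive (s : R) 1 g (g1 s), g1 t = d
    & is_derive t 1 (w * g1) c].

Lemma wder2_eq w g t d c d' c' :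
  wder2 w g t d c -> d = d' -> c = c' -> wder2 w g t d' c'.
Proof. by move=> H <- <-. Qed.

Lemma wder2_cst w t k : wder2 w (cst k) t 0 0.
Proof.
exists (cst 0); split => //; first by near=> s; exact: is_derive_cst.
have -> : w * cst 0 = cst (0 : R) by apply/funext => s; rewrite /= mulrfctE mulr0.
exact: is_derive_cst.
Unshelve. all: by end_near. Qed.

Lemma wder2D w g f t d d' c c' : wder2 w g t d c -> wder2 w f t d' c' ->
  wder2 w (fun s => g s + f s) t (d + d') (c + c').
Proof.
move=> [g1 [dg <- dwg]] [f1 [df <- dwf]]; exists (g1 + f1); split => //.
  near=> s; have ? : is_derive (s : R) 1 g (g1 s) by near: s.
  have ? : is_derive (s : R) 1 f (f1 s) by near: s.
  exact: is_deriveD.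
have -> : w * (g1 + f1) = w * g1 + w * f1 by rewrite mulrDr.
exact: is_deriveD.
Unshelve. all: by end_near. Qed.

Lemma wder2M w g f t d d' c c' : wder2 w g t d c -> wder2 w f t d' c' ->
  wder2 w (fun s => g s * f s) t (f t * d + g t * d')
    (f t * c + g t * c' + 2 * (w t * d * d')).
Proof.
move=> [g1 [dg <- dwg]] [f1 [df <- dwf]].
exists (fun s => f s * g1 s + g s * f1 s); split => //.
  near=> s; have ? : is_derive (s : R) 1 g (g1 s) by near: s.
  have ? : is_derive (s : R) 1 f (f1 s) by near: s.
  by apply: is_derive_eq; rewrite addrC.
have dgt : is_derive t 1 g (g1 t) by exact: nbhs_singleton dg.
have dft : is_derive t 1 f (f1 t) by exact: nbhs_singleton df.
have -> : w * (fun s => f s * g1 s + g s * f1 s) = f * (w * g1) + g * (w * f1).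
  by apply/funext => s; rewrite !fctE; ring.
have H := is_deriveD (is_deriveM dft dwg) (is_deriveM dgt dwf).
apply: is_derive_eq H _; rewrite !fctE /GRing.scale /=; ring.
Unshelve. all: by end_near. Qed.

Lemma wder2Z w g t d c k : wder2 w g t d c ->
  wder2 w (fun s => k * g s) t (k * d) (k * c).
Proof.
move=> gt; have := wder2M (wder2_cst w t k) gt.
by rewrite !(mulr0, mul0r, add0r, addr0).
Qed.

Lemma wder2_comp w g t d c (F F1 : R -> R) F2 :
  wder2 w g t d c ->
  (\forall y \near g t, is_derive (y : R) 1 F (F1 y)) -> is_derive (g t) 1 F1 F2 ->
  wder2 w (F \o g) t (F1 (g t) * d) (F1 (g t) * c + F2 * (w t * d ^+ 2)).
Proof.
move=> [g1 [dg <- dwg]] dF dF1; exists (fun s => F1 (g s) * g1 s).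
have dgt : is_derive t 1 g (g1 t) by exact: nbhs_singleton dg.
have gc : {for t, continuous g}.
  apply: differentiable_continuous; apply/derivable1_diffP.
  exact: ex_derive.
split => //.
  have : \forall s \near t, is_derive (g s : R) 1 F (F1 (g s)) by exact: gc dF.
  move=> dFg; near=> s; have dgs : is_derive (s : R) 1 g (g1 s) by near: s.
  have dFgs : is_derive (g s : R) 1 F (F1 (g s)) by near: s.
  exact: is_derive1_comp dFgs dgs.
have -> : w * (fun s => F1 (g s) * g1 s) = (F1 \o g) * (w * g1).
  by apply/funext => s; rewrite !fctE /=; ring.
have H := is_deriveM (@is_derive1_comp _ _ _ _ _ _ dF1 dgt) dwg.
apply: is_derive_eq H _; rewrite !fctE /GRing.scale /=; ring.
Unshelve. all: by end_near. Qed.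

Lemma is_derive_quad t b c (s : R) :
  is_derive s 1 (fun r : R => t + b * r + c * r ^+ 2) (b + 2 * c * s).
Proof.
have H := is_deriveD (is_deriveD (is_derive_cst t s 1)
  (is_deriveZ b (is_derive_id s 1))) (is_deriveZ c (is_deriveX 2 (is_derive_id s 1))).
apply: is_derive_eq H _; rewrite !scaler1 add0r -mulr_natl /GRing.scale /=.
by congr (_ + _); ring.
Qed.

Lemma is_derive_affine b c (s : R) : is_derive s 1 (fun r : R => b + c * r) c.
Proof.
have H := is_deriveD (is_derive_cst b s 1) (is_deriveZ c (is_derive_id s 1)).
by apply: is_derive_eq H _; rewrite add0r scaler1.
Qed.

Lemma wder2_quad k t b c :
  wder2 (cst k) (fun s => t + b * s + c * s ^+ 2) 0 b (k * (2 * c)).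
Proof.
exists (fun s => b + 2 * c * s); split.
- by near=> s; exact: is_derive_quad.
- by rewrite mulr0 addr0.
rewrite (_ : cst k * _ = (fun s => k * b + k * (2 * c) * s)).
  exact: is_derive_affine.
by apply/funext => y; rewrite !fctE; ring.
Unshelve. all: by end_near. Qed.

Lemma wder2_powR a k t : 0 < t ->
  wder2 (@powR R ^~ a) (@powR R ^~ k) t (k * t `^ (k - 1))
    (k * (a + k - 1) * t `^ (a + k - 2)).
Proof.
move=> t0; exists (fun s => k * s `^ (k - 1)); split => //.
  near=> s; apply: is_derive1_powR; near: s; exact: lt_nbhsr.
have : is_derive t 1 (k *: (@powR R ^~ (a + k - 1)))
    (k *: ((a + k - 1) * t `^ (a + k - 1 - 1))).
  by apply: is_deriveZ; exact: is_derive1_powR.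
rewrite (_ : a + k - 2 = a + k - 1 - 1); last by ring.
rewrite -mulrA => H.
apply: (@near_eq_is_derive _ _ _ (k *: (@powR R ^~ (a + k - 1)))) => //.
near=> s; have s0 : 0 < s by near: s; exact: lt_nbhsr.
rewrite !fctE /GRing.scale /= [RHS]mulrCA; congr (_ * _).
rewrite -powRD; first by congr (_ `^ _); ring.
by rewrite (gt_eqF s0) implybT.
Unshelve. all: by end_near. Qed.

Lemma near_itv (P : R -> Prop) t : (\forall s \near t, P s) ->
  exists2 e, 0 < e & forall s, t - e < s < t + e -> P s.
Proof.
move=> /(@nbhs_ballP R R)[e /= e0 eP]; exists e => // s /andP[ts se]; apply: eP => //.
by rewrite /ball /= ltr_norml; apply/andP; split; lra.
Qed.

Lemma near_right_itv (P : R -> Prop) t : (\forall s \near t^'+, P s) ->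
  exists2 e, 0 < e & forall s, t < s < t + e -> P s.
Proof.
move=> /(@nbhs_ballP R R)[e /= e0 eP]; exists e => // s /andP[ts se]; apply: eP => //.
by rewrite /ball /= ltr_norml; apply/andP; split; lra.
Qed.

(** Continuity at [t] is asked from the right only, so that the lemma also serves at the boundary
    point 0, where the weighted derivative has merely a limit. *)
Lemma right_increasing g g1 t : g @ t^'+ --> g t ->
  (\forall s \near t^'+, is_derive (s : R) 1 g (g1 s)) ->
  (\forall s \near t^'+, 0 < g1 s) -> \forall s \near t^'+, g t < g s.
Proof.
move=> gt dg g1_gt0; have [e e0 eP] := near_right_itv (filterI dg g1_gt0).
near=> s.
have ts : t < s by near: s; exact: nbhs_right_gt.
have se : s < t + e by near: s; apply: nbhs_right_lt; rewrite ltrDl.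
have dgr r : t < r < t + e -> is_derive r 1 g (g1 r) by move=> /eP[].
have gc r : t < r < t + e -> {for r, continuous g}.
  move=> /dgr rt; apply: differentiable_continuous; apply/derivable1_diffP.
  exact: ex_derive.
have [||r] := @MVT _ g g1 t s ts.
- by move=> r; rewrite in_itv /= => /andP[tr rs]; apply: dgr; lra.
- apply/continuous_within_itvP => //; split => //.
  + by move=> r; rewrite in_itv /= => /andP[tr rs]; apply: gc; lra.
  + by apply: cvg_at_left_filter; apply: gc; lra.
rewrite in_itv /= => /andP[tr rs] E.
by rewrite -subr_gt0 E mulr_gt0 ?subr_gt0//; apply: (eP r _).2; lra.
Unshelve. all: by end_near. Qed.

(** At a maximum [g1 t = 0], so [w * g1] vanishes at [t]. If its derivative [c] were positive,
    [w * g1], hence [g1], would be positive just to the right and [g] would increase past its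
    maximum. *)
Lemma wder2_local_max w g t d c :
  (\forall s \near t, 0 < w s) -> wder2 w g t d c ->
  (\forall s \near t, g s <= g t) -> c <= 0.
Proof.
move=> w_gt0 [g1 [dg g1t dwg]] gmax; rewrite leNgt; apply/negP => c0.
have dgt : is_derive t 1 g (g1 t) by exact: nbhs_singleton dg.
have g1t0 : g1 t = 0.
  have [e e0 eP] := near_itv (filterI dg gmax).
  have H : is_derive t 1 g 0.
    apply: (@derive1_at_max _ _ (t - e) (t + e)); first lra.
    - move=> s; rewrite in_itv /= => /andP[s1 s2]; apply: ex_derive.
      by apply: (eP s _).1; lra.
    - by rewrite in_itv/=; apply/andP; split; lra.
    - move=> s; rewrite in_itv /= => /andP[s1 s2].
      by apply: (eP s _).2; lra.
  by rewrite -(@derive_val _ _ _ _ _ _ _ dgt) derive_val.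
have g1_gt0 : \forall s \near t^'+, 0 < g1 s.
  have dk := @ex_derive _ _ _ _ _ _ _ dwg.
  have kc : (fun h : R => h^-1 *: (((w * g1) \o shift t) (h *: 1) - (w * g1) t))
      @ 0^' --> c.
    by rewrite -(@derive_val _ _ _ _ _ _ _ dwg); exact: dk.
  have {}kc := cvgr_gt _ kc _ c0.
  move: kc; rewrite near_withinE => kc; have [e e0 eP] := near_itv (kc _).
  near=> s.
  have ts : t < s by near: s; exact: nbhs_right_gt.
  have se : s < t + e by near: s; apply: nbhs_right_lt; rewrite ltrDl.
  have ws : 0 < w s by near: s; exact: cvg_within w_gt0.
  have /eP : 0 - e < s - t < 0 + e by lra.
  rewrite !fctE /= g1t0 mulr0 subr0 /GRing.scale /= mulr1 subrK.
  rewrite subr_eq0 gt_eqF// => /(_ isT).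
  by rewrite pmulr_rgt0 ?invr_gt0 ?subr_gt0// pmulr_rgt0.
have gt : g @ t^'+ --> g t.
  apply: cvg_at_right_filter; apply: differentiable_continuous.
  by apply/derivable1_diffP; exact: ex_derive.
have ginc := right_increasing gt (cvg_within _ dg) g1_gt0.
near t^'+ => s.
have : g t < g s by near: s; exact: ginc.
have : g s <= g t by near: s; exact: cvg_within gmax.
by lra.
Unshelve. all: by end_near. Qed.

Lemma conormal_local_max (a l : R) g g1 :
  g @ 0^'+ --> g 0 ->
  (\forall s \near 0^'+, is_derive (s : R) 1 g (g1 s)) ->
  (s `^ a * g1 s @[s --> 0^'+]) --> l ->
  (\forall s \near 0^'+, g s <= g 0) -> l <= 0.
Proof.
move=> g0 dg dl gmax; rewrite leNgt; apply/negP => l0.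
have g1_gt0 : \forall s \near 0^'+, 0 < g1 s.
  near=> s.
  have : 0 < s `^ a * g1 s by near: s; exact: (cvgr_gt _ dl _ l0).
  by rewrite pmulr_rgt0// powR_gt0//; near: s; exact: nbhs_right_gt.
have ginc := right_increasing g0 dg g1_gt0.
near (0 : R)^'+ => s.
have : g 0 < g s by near: s; exact: ginc.
have : g s <= g 0 by near: s; exact: gmax.
by lra.
Unshelve. all: by end_near. Qed.

End OneDimensional.

Section WeightedDivergence.
Context {R : realType}.

(** The hypothesis on [z] makes the difference quotient of [w \o z] at [s] literally that of [w] in
    direction [e]. *)
Lemma is_derive_line (V : normedModType R) (w : V -> R) (z : R -> V) (s : R)
    (e : V) :
  (forall h, z (h + s) = h *: e + z s) -> derivable w (z s) e ->
  is_derive s 1 (w \o z) ('D_e w (z s)).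
Proof.
move=> zE dw.
have E : (fun h : R => h^-1 *: ((w \o z \o shift s) (h *: 1) - (w \o z) s))
    = (fun h : R => h^-1 *: ((w \o shift (z s)) (h *: e) - w (z s))).
  by apply/funext => h; rewrite /= /GRing.scale /= mulr1 zE.
by split; rewrite /derivable /derive E.
Qed.

Variables (n : nat).
Implicit Types (a : R) (F : 'rV[R]_n * R -> R) (p : 'rV[R]_n * R).

(* [div (lambda^a grad F) p = c]. Unlike [C2], this is a condition at [p] only and is
   stable under the operations needed to build explicit barriers. *)
Definition wdiv a F p c : Prop :=
  exists (d e : 'I_n -> R) (d' e' : R),
  [/\ forall i, wder2 (cst (p.2 `^ a))
                  (fun s => F (p.1 + s *: delta_mx 0 i, p.2)) 0 (d i) (e i),
      wder2 (@powR R ^~ a) (fun l => F (p.1, l)) p.2 d' e'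
    & c = \sum_(i < n) e i + e'].

Lemma wdivD a F G p c c' : wdiv a F p c -> wdiv a G p c' ->
  wdiv a (fun q => F q + G q) p (c + c').
Proof.
move=> [d [e [d1 [e1 [dF dF1 ->]]]]] [d' [e' [d1' [e1' [dG dG1 ->]]]]].
exists (fun i => d i + d' i), (fun i => e i + e' i), (d1 + d1'), (e1 + e1').
split; first by move=> i; exact: wder2D.
- exact: wder2D.
- by rewrite big_split /=; ring.
Qed.

Lemma wdivZ a F p c k : wdiv a F p c -> wdiv a (fun q => k * F q) p (k * c).
Proof.
move=> [d [e [d1 [e1 [dF dF1 ->]]]]].
exists (fun i => k * d i), (fun i => k * e i), (k * d1), (k * e1).
split; first by move=> i; exact: wder2Z.
- exact: wder2Z.
- by rewrite mulrDr mulr_sumr.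
Qed.

Lemma wdiv_cst a p k : wdiv a (cst k) p 0.
Proof.
exists (fun=> 0), (fun=> 0), 0, 0; split.
- by move=> i; exact: wder2_cst.
- exact: wder2_cst.
- by rewrite big1 ?addr0.
Qed.

Lemma cvg_line (x e : 'rV[R]_n) (l : R) :
  (x + s *: e, l) @[s --> (0 : R)] --> (x, l).
Proof.
apply: (@cvg_pair _ _ _ _ (nbhs x) (nbhs l)); last exact: cvg_cst.
suff : x + s *: e @[s --> (0 : R)] --> x + 0 *: e by rewrite scale0r addr0.
by apply: cvgD; [exact: cvg_cst|apply: cvgZr_tmp; exact: cvg_id].
Qed.

Lemma wdiv_local_max a F p c : 0 < p.2 -> wdiv a F p c ->
  (\forall q \near p, F q <= F p) -> c <= 0.
Proof.
case: p => x l /= l0 [d [e [d1 [e1 [/= dF dF1 ->]]]]] Fmax.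
rewrite -[leRHS]addr0; apply: lerD.
  apply: sumr_le0 => i _; apply: (wder2_local_max _ (dF i)).
    by near=> s; rewrite powR_gt0.
  have := @cvg_line x (delta_mx 0 i) l _ Fmax.
  by rewrite /= scale0r addr0.
apply: (wder2_local_max _ dF1).
  by near=> s; rewrite powR_gt0//; near: s; exact: lt_nbhsr.
have : (x, s) @[s --> l] --> (x, l).
  by apply: (@cvg_pair _ _ _ _ (nbhs x) (nbhs l)); [exact: cvg_cst|exact: cvg_id].
by move=> /(_ _ Fmax).
Unshelve. all: by end_near. Qed.

(** Bridge from the regularity of the statement to the line-wise calculus: openness of [D] gives the
    first derivatives at all nearby points of each coordinate line through [p]. *)
Lemma wdiv_C2 a (D : set ('rV[R]_n * R)) w p : open D -> C2 D w -> D p ->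
  0 < p.2 -> wdiv a w p (div_weighted_grad a w p).
Proof.
case: p => x l oD wD Dp /= l0.
have nD : \forall q \near (x, l), D q by exact: open_nbhs_nbhs.
pose E i : 'rV[R]_n * R := (delta_mx 0 i, 0).
pose F i (q : 'rV[R]_n * R) := q.2 `^ a * dx i w q.
pose G (q : 'rV[R]_n * R) := q.2 `^ a * dlam w q.
exists (fun i => dx i w (x, l)), (fun i => dx i (F i) (x, l)),
  (dlam w (x, l)), (dlam G (x, l)); split => //=.
- move=> i; pose z (s : R) := (x + s *: delta_mx 0 i, l) : 'rV[R]_n * R.
  have z0 : z 0 = (x, l) by rewrite /z scale0r addr0.
  have zE s h : z (h + s) = h *: E i + z s.
    apply: injective_projections => /=; last by rewrite scaler0 add0r.
    by rewrite scalerDl addrCA.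
  exists (fun s => dx i w (z s)); split.
  + near=> s; have Ds : D (z s) by near: s; exact: (@cvg_line x (delta_mx 0 i) l _ nD).
    apply: (@is_derive_line _ w z s (E i)); first exact: zE.
    by have [_ /(_ (E i))[]] := wD _ Ds.
  + by rewrite z0.
  + have -> : cst (l `^ a) * (fun s => dx i w (z s)) = F i \o z.
      by apply/funext.
    rewrite -z0; apply: (@is_derive_line _ (F i) z 0 (E i)) => //; rewrite z0.
    have H : derivable (fun h : R => dx i w (h *: E i + (x, l))) 0 1.
      apply: (derivable1P (dx i w) (x, l) (E i)).1.
      by have [_ _ /(_ (E i) (E i))[]] := wD _ Dp.
    apply: (derivable1P (F i) (x, l) (E i)).2.
    have -> : (fun h : R => F i (h *: E i + (x, l)))
        = l `^ a \*: (fun h : R => dx i w (h *: E i + (x, l))).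
      by apply/funext => h; rewrite /F /= scaler0 add0r.
    exact: derivableZ H.
- pose z (s : R) := (x, s) : 'rV[R]_n * R.
  have zE s h : z (h + s) = h *: ((0, 1) : 'rV[R]_n * R) + z s.
    apply: injective_projections => /=; first by rewrite scaler0 add0r.
    by rewrite /GRing.scale/= mulr1.
  exists (fun s => dlam w (z s)); split; first last.
  + have -> : (@powR R ^~ a) * (fun s => dlam w (z s)) = G \o z by [].
    have H : derivable (fun h : R => dlam w (h *: (0, 1) + (x, l))) 0 1.
      apply: (derivable1P (dlam w) (x, l) (0, 1)).1.
      by have [_ _ /(_ (0, 1) (0, 1))[]] := wD _ Dp.
    apply: (@is_derive_line _ G z l (0, 1)); first exact: zE.
    apply: (derivable1P G (x, l) (0, 1)).2.
    have -> : (fun h : R => G (h *: (0, 1) + (x, l)))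
        = (fun h : R => (h + l) `^ a) * (fun h : R => dlam w (h *: (0, 1) + (x, l))).
      by apply/funext => h; rewrite /G /= /GRing.scale /= mulr1.
    apply: derivableM; last exact: H.
    have H1 : is_derive ((id + cst l) (0 : R)) 1 (@powR R ^~ a)
        (a * l `^ (a - 1)).
      by rewrite !fctE add0r; exact: is_derive1_powR.
    have H2 := is_deriveD (is_derive_id (0 : R) 1) (is_derive_cst l (0 : R) 1).
    exact: (@ex_derive _ _ _ _ _ _ _ (is_derive1_comp H1 H2)).
  + by [].
  + have xl : (x, s) @[s --> l] --> (x, l).
      by apply: (@cvg_pair _ _ _ _ (nbhs x) (nbhs l)); [exact: cvg_cst|exact: cvg_id].
    near=> s; have Ds : D (z s) by near: s; exact: (xl _ nD).
    apply: (@is_derive_line _ w z s (0, 1)); first exact: zE.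
    by have [_ /(_ (0, 1))[]] := wD _ Ds.
Unshelve. all: by end_near. Qed.

End WeightedDivergence.

(** * Explicit barriers *)

Section QuadraticForms.
Context {R : realType} {n : nat}.
Implicit Types (c : 'I_n -> R) (x : 'rV[R]_n).

(** Two instances matter: [cst 1] gives [|x|^2], and the signature of the Simons cone gives
    [s^2 - t^2]. *)
Definition diagq c x : R := \sum_(i < n) c i * x 0 i ^+ 2.

Lemma diagq_line c x i s : diagq c (x + s *: delta_mx 0 i)
  = diagq c x + 2 * c i * x 0 i * s + c i * s ^+ 2.
Proof.
rewrite /diagq (bigD1 i)//= [in RHS](bigD1 i)//= !mxE !eqxx /= mulr1.
rewrite (eq_bigr (fun j => c j * x 0 j ^+ 2)); last first.
  by move=> j ji; rewrite !mxE (negbTE ji) andbF mulr0 addr0.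
ring.
Qed.

Lemma wder2_diagq k c x i :
  wder2 (cst k) (fun s => diagq c (x + s *: delta_mx 0 i)) 0
    (2 * c i * x 0 i) (k * (2 * c i)).
Proof.
rewrite (_ : (fun s => _) =
  (fun s => diagq c x + 2 * c i * x 0 i * s + c i * s ^+ 2)); last first.
  by apply/funext => s; rewrite diagq_line.
exact: wder2_quad.
Qed.

Lemma diagq_ge0 c x : (forall i, 0 <= c i) -> 0 <= diagq c x.
Proof. by move=> c0; apply: sumr_ge0 => i _; rewrite mulr_ge0 ?sqr_ge0. Qed.

Lemma enorm_ge0 x : 0 <= enorm x. Proof. exact: sqrtr_ge0. Qed.

Lemma sqr_enorm x : enorm x ^+ 2 = diagq (cst 1) x.
Proof.
rewrite sqr_sqrtr; last by apply: sumr_ge0 => i _; rewrite sqr_ge0.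
by apply: eq_bigr => i _; rewrite mul1r.
Qed.

End QuadraticForms.

Section Barrier.
Context {R : realType} {n : nat} (g a : R).
Hypotheses (g01 : 0 < g < 1) (aE : a = 1 - 2 * g).

(* The logarithm makes it proper; its positive divergence is absorbed by the power
   [p.2 `^ g], whose exponent lies below that of the harmonic [p.2 `^ (2 * g)]. *)
Definition barrier (p : 'rV[R]_n * R) : R :=
  ln (1 + diagq (cst 1) p.1 + p.2 `^ 2) + (2 * n%:R + 5) / g ^+ 2 * p.2 `^ g.

(** With [S = 1 + |x|^2 + l^2], the logarithm contributes at most
    [(2 * n + 2 * (a + 1)) * l ^ a / S], and the power contributes
    [- (2 * n + 5) * l ^ (a + g - 2)], because [g * (a + g - 1) = - g ^ 2]. Since
    [l ^ (2 - g) <= 1 + l^2 <= S], the second term wins as soon as [2 * (a + 1) < 5]. *)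
Lemma barrier_wdiv (p : 'rV[R]_n * R) : 0 < p.2 ->
  exists2 c, wdiv a barrier p c & c < 0.
Proof.
case: p => x l /= l0; set K := (2 * n%:R + 5) / g ^+ 2.
pose S := 1 + diagq (cst 1) x + l `^ 2.
have q0 : 0 <= diagq (cst 1) x by apply: diagq_ge0 => i; exact: ler01.
have l2 : l `^ 2 = l ^+ 2 by rewrite powR_mulrn// ltW.
have S1 : 1 + l ^+ 2 <= S by rewrite /S l2; lra.
have S0 : 0 < S by apply: lt_le_trans S1; have := sqr_ge0 l; lra.
have dln : \forall y \near S, is_derive (y : R) 1 (@ln R) y^-1.
  by near=> y; apply: is_derive1_ln; near: y; exact: lt_nbhsr.
have dinv : is_derive S 1 (@GRing.inv R) (- S ^- 2).
  have := @is_deriveV R id S 1 1 _ (is_derive_id S 1).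
  by rewrite gt_eqF//= /GRing.scale /= mulr1; apply.
exists (\sum_(i < n) (S^-1 * (l `^ a * 2) - S ^- 2 * (l `^ a * (2 * x 0 i) ^+ 2))
  + (S^-1 * (2 * (a + 1) * l `^ a) - S ^- 2 * (l `^ a * (2 * l) ^+ 2)
  - K * g ^+ 2 * l `^ (a + g - 2))).
  exists (fun i => S^-1 * (2 * x 0 i)),
    (fun i => S^-1 * (l `^ a * 2) - S ^- 2 * (l `^ a * (2 * x 0 i) ^+ 2)),
    (S^-1 * (2 * l) + K * (g * l `^ (g - 1))),
    (S^-1 * (2 * (a + 1) * l `^ a) - S ^- 2 * (l `^ a * (2 * l) ^+ 2)
      - K * g ^+ 2 * l `^ (a + g - 2)).
  split=> //=.
    move=> i; set G := fun s => 1 + diagq (cst 1) (x + s *: delta_mx 0 i) + l `^ 2.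
    have G0 : G 0 = S by rewrite /G scale0r addr0.
    have dG : wder2 (cst (l `^ a)) G 0 (2 * x 0 i) (l `^ a * 2).
      have := wder2D (wder2D (wder2_cst (cst (l `^ a)) 0 1)
        (wder2_diagq (l `^ a) (cst 1) x i)) (wder2_cst _ _ (l `^ 2)).
      by move/wder2_eq; apply; rewrite /=; ring.
    rewrite -G0 in dln dinv.
    have := wder2D (wder2_comp dG dln dinv) (wder2_cst _ _ (K * l `^ g)).
    by rewrite G0; move/wder2_eq; apply; rewrite /=; ring.
  set G := fun s => 1 + diagq (cst 1) x + s `^ 2.
  have dG : wder2 (@powR R ^~ a) G l (2 * l) (2 * (a + 1) * l `^ a).
    have := wder2D (wder2_cst _ _ (1 + diagq (cst 1) x)) (wder2_powR a 2 l0).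
    move/wder2_eq; apply.
      by rewrite add0r (_ : 2 - 1 = 1) ?powRr1 ?ltW//; ring.
    by rewrite add0r (_ : a + 2 - 2 = a); [congr (_ * _); ring|ring].
  have := wder2D (wder2_comp dG dln dinv) (wder2Z K (wder2_powR a g l0)).
  by move/wder2_eq; apply => //; rewrite aE /=; ring.
have la : 0 < l `^ a by rewrite powR_gt0.
have /andP[g0 g1] := g01.
have sum_le : \sum_(i < n) (S^-1 * (l `^ a * 2) - S ^- 2 * (l `^ a * (2 * x 0 i) ^+ 2))
    <= S^-1 * l `^ a * (2 * n%:R).
  have : \sum_(i < n) (S^-1 * l `^ a * 2) = S^-1 * l `^ a * (2 * n%:R).
    by rewrite sumr_const card_ord -mulr_natr; ring.
  move=> <-; apply: ler_sum => i _; rewrite mulrA gerBl.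
  by rewrite mulr_ge0 ?invr_ge0 ?sqr_ge0// mulr_ge0 ?sqr_ge0 ?ltW.
have term_ge0 : 0 <= S ^- 2 * (l `^ a * (2 * l) ^+ 2).
  by rewrite mulr_ge0 ?invr_ge0 ?sqr_ge0// mulr_ge0 ?sqr_ge0 ?ltW.
have lg : S^-1 <= l `^ (g - 2).
  rewrite (_ : g - 2 = - (2 - g)); last by ring.
  rewrite powRN lef_pV2 ?posrE ?powR_gt0//; apply: le_trans S1.
  have [l1|l1] := leP l 1.
    have : l `^ (2 - g) <= 1 `^ (2 - g) by apply: ge0_ler_powR; rewrite ?nnegrE//; lra.
    by rewrite powR1; have := sqr_ge0 l; lra.
  have : l `^ (2 - g) <= l `^ 2 by apply: ler_powR; lra.
  by rewrite l2; lra.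
have : l `^ (a + g - 2) = l `^ a * l `^ (g - 2).
  rewrite -powRD; first by congr (_ `^ _); ring.
  by rewrite (gt_eqF l0) implybT.
move=> ->; rewrite (_ : K * g ^+ 2 = 2 * n%:R + 5); last first.
  by rewrite /K divfK// expf_neq0// gt_eqF.
have n0 : 0 <= n%:R :> R by exact: ler0n.
have Kle : (2 * n%:R + 5) * (l `^ a * S^-1) <= (2 * n%:R + 5) * (l `^ a * l `^ (g - 2)).
  by apply: ler_wpM2l; [lra|rewrite ler_pM2l].
have laS : 0 < l `^ a * S^-1 by rewrite mulr_gt0 ?invr_gt0.
have a1 : a < 1 by rewrite aE; lra.
suff : S^-1 * l `^ a * (2 * n%:R) + S^-1 * (2 * (a + 1) * l `^ a)
    < (2 * n%:R + 5) * (l `^ a * S^-1) by lra.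
rewrite -subr_gt0 (_ : _ - _ = (3 - 2 * a) * (l `^ a * S^-1)); last by ring.
by rewrite mulr_gt0//; lra.
Unshelve. all: by end_near. Qed.

End Barrier.

Section Profile.
Context {R : realType} (g a : R).
Hypotheses (g01 : 0 < g < 1) (aE : a = 1 - 2 * g).

(* [l `^ (2 * g)] is annihilated by [div (lambda^a grad)] and carries the whole
   conormal derivative, while [l `^ 2] has a divergence of constant sign. *)
Definition profile (k c l : R) : R :=
  1 + (- k) * l `^ (2 * g) + c * l `^ 2.

Lemma profile0 k c : profile k c 0 = 1.
Proof.
have /andP[g0 g1] := g01.
have g2 : 2 * g != 0 by rewrite gt_eqF// mulr_gt0.
by rewrite /profile !powR0 ?pnatr_eq0// !mulr0 !addr0.
Qed.

Lemma profile_wder2 k c l : 0 < l ->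
  exists d, wder2 (@powR R ^~ a) (profile k c) l d (2 * c * (1 + a) * l `^ a).
Proof.
move=> l0; eexists.
have := wder2D (wder2D (wder2_cst _ _ 1) (wder2Z (- k) (wder2_powR a (2 * g) l0)))
  (wder2Z c (wder2_powR a 2 l0)).
move/wder2_eq; apply; first reflexivity.
rewrite (_ : a + 2 - 2 = a); last by ring.
by rewrite aE; ring.
Qed.

Lemma profile_conormal k c : exists p1 : R -> R,
  (forall s : R, 0 < s -> is_derive s 1 (profile k c) (p1 s)) /\
  s `^ a * p1 s @[s --> 0^'+] --> - (2 * g * k).
Proof.
have /andP[g0 g1] := g01.
exists (fun s => - k * (2 * g * s `^ (2 * g - 1)) + c * (2 * s `^ (2 - 1))); split.
  move=> s s0.
  have H1 := is_deriveZ (- k) (is_derive1_powR (2 * g) s0).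
  have H2 := is_deriveZ c (is_derive1_powR 2 s0).
  have := is_deriveD (is_deriveD (is_derive_cst (1 : R) s 1) H1) H2.
  by rewrite add0r.
have H : - (2 * g * k) + 2 * c * s `^ (1 + a) @[s --> 0^'+] --> - (2 * g * k) + 2 * c * 0.
  apply: cvgD; first exact: cvg_cst.
  by apply: cvgM; [exact: cvg_cst|apply: powR_cvg0; rewrite aE; lra].
rewrite mulr0 addr0 in H; apply: cvg_trans H; apply: near_eq_cvg; near=> s.
have s0 : 0 < s by near: s; exact: nbhs_right_gt.
have E b : s `^ a * s `^ b = s `^ (a + b).
  by rewrite powRD// (gt_eqF s0) implybT.
have Ea : s `^ a * s `^ (2 * g - 1) = 1.
  by rewrite E (_ : _ + _ = 0) ?powRr0// aE; ring.
have Eb : s `^ (1 + a) = s `^ a * s `^ (2 - 1) by rewrite E; congr (_ `^ _); ring.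
rewrite Eb; transitivity (- (2 * g * k) * (s `^ a * s `^ (2 * g - 1))
  + 2 * c * (s `^ a * s `^ (2 - 1))); [by rewrite Ea mulr1|ring].
Unshelve. all: by end_near. Qed.

(** The height [l1] is where [A * l ^ (2 * g)] reaches 1/4. Below it the loss is at most 1/4; the
    value of [B] makes [B * l ^ 2] equal to [A * l ^ (2 * g)] at [l1], and larger beyond, since
    [2 * g < 2]. *)
Lemma profile_lower A : 0 < A ->
  exists2 B, 0 < B & forall l, 0 <= l -> 3 / 4 <= profile A B l.
Proof.
have /andP[g0 g1] := g01.
move=> A0; pose l1 := (4 * A)^-1 `^ (2 * g)^-1.
have A4 : 0 < (4 * A)^-1 by rewrite invr_gt0 mulr_gt0.
have l1_gt0 : 0 < l1 by rewrite powR_gt0.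
have l1E : l1 `^ (2 * g) = (4 * A)^-1.
  by rewrite -powRrM mulVf ?powRr1 ?ltW// gt_eqF// mulr_gt0.
exists (A * l1 `^ (2 * g - 2)); first by rewrite mulr_gt0 ?powR_gt0.
move=> l l0; rewrite /profile.
have [ll1|ll1] := leP l l1.
  have : l `^ (2 * g) <= (4 * A)^-1.
    by rewrite -l1E; apply: ge0_ler_powR; rewrite ?nnegrE//; lra.
  move=> H; have {}H : A * l `^ (2 * g) <= A * (4 * A)^-1 by rewrite ler_pM2l.
  have AE : A * (4 * A)^-1 = 4^-1 by field; rewrite gt_eqF.
  have : 0 <= A * l1 `^ (2 * g - 2) * l `^ 2 by rewrite !mulr_ge0 ?powR_ge0 ?ltW.
  by lra.
have {}l0 : 0 < l by lra.
suff : A * l `^ (2 * g) <= A * l1 `^ (2 * g - 2) * l `^ 2 by lra.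
rewrite -mulrA ler_pM2l// (_ : 2 * g = (2 * g - 2) + 2); last by ring.
rewrite powRD; last by rewrite (gt_eqF l0) implybT.
rewrite (_ : 2 * g - 2 + 2 - 2 = - (2 - 2 * g)); last by ring.
rewrite (_ : 2 * g - 2 = - (2 - 2 * g)); last by ring.
rewrite ler_pM2r ?powR_gt0// !powRN lef_pV2 ?posrE ?powR_gt0//.
by apply: ge0_ler_powR; rewrite ?nnegrE//; lra.
Qed.

(** At [h] the power term equals 2 and the quadratic term 1, so the value is [1 - 2 + 1]. The
    profile may become negative before [h]; this is harmless for a subsolution, which is compared
    only where it is positive. *)
Lemma profile_cap k : 0 < k -> exists c h, [/\ 0 < c, 0 < h,
  profile k c h = 0 & forall l, 0 <= l <= h -> profile k c l <= 2].
Proof.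
have /andP[g0 g1] := g01.
move=> k0; pose h := (2 / k) `^ (2 * g)^-1.
have k2 : 0 < 2 / k by rewrite divr_gt0.
have h0 : 0 < h by rewrite powR_gt0.
have hE : h `^ (2 * g) = 2 / k.
  by rewrite -powRrM mulVf ?powRr1 ?ltW// gt_eqF// mulr_gt0.
have h2 : 0 < h `^ 2 by rewrite powR_gt0.
exists (h `^ 2)^-1, h; split => //.
- by rewrite invr_gt0.
- have kE : k * (2 / k) = 2 by field; rewrite gt_eqF.
  by rewrite /profile hE mulVf ?gt_eqF// mulNr kE; ring.
move=> l /andP[l0 lh]; rewrite /profile.
have : 0 <= k * l `^ (2 * g) by rewrite mulr_ge0 ?powR_ge0 ?ltW.
suff : (h `^ 2)^-1 * l `^ 2 <= 1 by lra.
rewrite mulrC ler_pdivrMr// mul1r.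
by apply: ge0_ler_powR; rewrite ?nnegrE//; lra.
Qed.

End Profile.

Section Separable.
Context {R : realType} {n : nat}.

Definition xder2 (X : 'rV[R]_n -> R) x (d e : 'I_n -> R) : Prop :=
  forall i, wder2 (cst 1) (fun s => X (x + s *: delta_mx 0 i)) 0 (d i) (e i).

Lemma wder2_weightZ w (f : R -> R) (k t d c : R) :
  wder2 w f t d c -> wder2 (cst k * w) f t d (k * c).
Proof.
move=> [f1 [df f1t dwf]]; exists f1; split=> //.
have -> : cst k * w * f1 = k \*: (w * f1).
  by apply/funext => s; exact: esym (mulrA k (w s) (f1 s)).
exact: is_deriveZ.
Qed.

Lemma wdiv_sep a (X : 'rV[R]_n -> R) (G : R -> R) x l d e d' e' :
  xder2 X x d e -> wder2 (@powR R ^~ a) G l d' e' ->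
  wdiv a (fun q => X q.1 * G q.2) (x, l)
    (l `^ a * G l * (\sum_(i < n) e i) + X x * e').
Proof.
move=> Xd Gd; exists (fun i => G l * d i), (fun i => l `^ a * G l * e i),
  (X x * d'), (X x * e'); split => /=.
- move=> i; have := wder2Z (G l) (wder2_weightZ (l `^ a) (Xd i)).
  rewrite (_ : (fun s => G l * _) = (fun s => X (x + s *: delta_mx 0 i) * G l)).
    rewrite (_ : cst (l `^ a) * cst 1 = cst (l `^ a)); last first.
      by apply/funext => s; rewrite !fctE mulr1.
    by move/wder2_eq; apply => //; ring.
  by apply/funext => s; rewrite mulrC.
- exact: wder2Z.
- by rewrite mulr_sumr.
Qed.

(** An explicit substitute for a first Dirichlet eigenfunction of the ball. Thanks to the square its
    Laplacian is positive near the sphere, where [C - |x - y|^2] is small. *)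
Definition sqbump (C : R) (y x : 'rV[R]_n) : R := (C - diagq (cst 1) (x - y)) ^+ 2.

Lemma sqbump_xder2 C y x : exists d e, xder2 (sqbump C y) x d e /\
  \sum_(i < n) e i = 8 * C - (4 * n%:R + 8) * (C - diagq (cst 1) (x - y)).
Proof.
set q := C - diagq (cst 1) (x - y).
exists (fun i => 2 * q * (- (2 * (x - y) 0 i))),
  (fun i => 8 * (1 * (x - y) 0 i ^+ 2) - 4 * q); split.
  move=> i; set G := fun s => C + -1 * diagq (cst 1) ((x - y) + s *: delta_mx 0 i).
  have G0 : G 0 = q by rewrite /G scale0r addr0 mulN1r.
  have dG : wder2 (cst 1) G 0 (- (2 * (x - y) 0 i)) (- 2).
    have := wder2D (wder2_cst (cst 1) 0 C)
      (wder2Z (-1) (wder2_diagq 1 (cst 1) (x - y) i)).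
    by move/wder2_eq; apply; rewrite /=; ring.
  have sq1 : \forall z \near G 0, is_derive (z : R) 1 (fun r : R => r ^+ 2) (2 * z).
    near=> z; have := is_derive_quad 0 0 1 z.
    rewrite mulr1 add0r (_ : (fun _ => _) = (fun r : R => r ^+ 2))//.
    by apply/funext => r; rewrite mul0r mul1r !add0r.
  have sq2 : is_derive (G 0) 1 (fun z : R => 2 * z) 2.
    have := is_derive_affine 0 2 (G 0).
    rewrite (_ : (fun _ => _) = (fun r : R => 2 * r))//.
    by apply/funext => r; rewrite add0r.
  have := wder2_comp dG sq1 sq2.
  rewrite (_ : _ \o G = fun s => sqbump C y (x + s *: delta_mx 0 i)).
    by move/wder2_eq; apply; rewrite G0 /=; ring.
  by apply/funext => s; rewrite /sqbump /G /= mulN1r addrAC.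
rewrite big_split /= -mulr_sumr sumr_const card_ord -mulr_natr.
rewrite (_ : \sum_(i < n) _ = diagq (cst 1) (x - y)); last by [].
by rewrite /q; ring.
Unshelve. all: by end_near. Qed.

End Separable.

Section ConeFunction.
Context {R : realType} {n : nat} (c : 'I_n -> R).
Hypotheses (c2 : forall i, c i ^+ 2 = 1) (sum_c : \sum_(i < n) c i = 0).

(* For [c = simons] this is [(s^2 - t^2) / |x|], comparable to the distance to the
   cone and, unlike [s - t], smooth across [t = 0]. *)
Definition conefun (x : 'rV[R]_n) : R :=
  diagq c x * diagq (cst 1) x `^ (- 2^-1).

(** Since the [c i] sum to zero, the quadratic form [q] is harmonic, and the Laplacian of [q / |x|]
    comes out as [- (n + 1) * q / |x|^3]. As [c i ^ 2 = 1], the squared gradient is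
    [4 - 3 * (q / |x|^2) ^ 2], which is at least 1 because [|q| <= |x|^2]. *)
Lemma conefun_xder2 x : 0 < diagq (cst 1) x -> 0 <= diagq c x ->
  `|diagq c x| <= diagq (cst 1) x ->
  exists d e, [/\ xder2 conefun x d e, \sum_(i < n) e i <= 0
    & 1 <= \sum_(i < n) d i ^+ 2].
Proof.
set y := diagq (cst 1) x; set q := diagq c x => y0 q0 qy.
set P := y `^ (- 2^-1).
have P0 : 0 < P by rewrite powR_gt0.
have PE k : y `^ (- 2^-1 - k%:R) = P / y ^+ k.
  by rewrite powRB ?(gt_eqF y0) ?implybT// powR_mulrn ?ltW.
have P2 : P ^+ 2 = y^-1.
  rewrite expr2 -powRD; last by rewrite (gt_eqF y0) implybT.
  by rewrite -(powR_inv1 (ltW y0)); congr (_ `^ _); field.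
pose P' := - 2^-1 * (P / y).
have P'E : - 2^-1 * y `^ (- 2^-1 - 1) = P' by rewrite (PE 1%N) expr1.
pose Sx := \sum_(i < n) x 0 i ^+ 2.
have SxE : Sx = y by apply: eq_bigr => i _; rewrite mul1r.
pose P'' := 3 / 4 * (P / y ^+ 2).
exists (fun i => P * (2 * c i * x 0 i) + q * (P' * (2 * x 0 i))),
 (fun i => P * (2 * c i) + q * (P' * 2 + P'' * (2 * x 0 i) ^+ 2)
   + 2 * ((2 * c i * x 0 i) * (P' * (2 * x 0 i)))); split.
- move=> i; set G := fun s => diagq (cst 1) (x + s *: delta_mx 0 i).
  have G0 : G 0 = y by rewrite /G scale0r addr0.
  have dG := wder2_diagq 1 (cst 1) x i.
  have p1 : \forall z \near G 0, is_derive (z : R) 1 (@powR R ^~ (- 2^-1))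
     (- 2^-1 * z `^ (- 2^-1 - 1)).
    by near=> z; apply: is_derive1_powR; near: z; apply: lt_nbhsr; rewrite G0.
  have p2 : is_derive (G 0) 1 (fun z : R => - 2^-1 * z `^ (- 2^-1 - 1)) P''.
    have y0' : 0 < G 0 by rewrite G0.
    have := is_deriveZ (- 2^-1) (is_derive1_powR (- 2^-1 - 1) y0').
    rewrite G0 (_ : - 2^-1 - 1 - 1 = - 2^-1 - 2%:R); last by ring.
    by rewrite PE /GRing.scale /= => H; apply: (is_derive_eq H); rewrite /P''; field; rewrite gt_eqF.
  have := wder2M (wder2_diagq 1 c x i) (wder2_comp dG p1 p2).
  by move/wder2_eq; apply; rewrite /= !scale0r !addr0 -/y -/q P'E -/P; ring.
- rewrite (eq_bigr (fun i => (2 * P) * c i + (2 * q * P') + (4 * q * P'') * x 0 i ^+ 2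
     + (8 * P') * (c i * x 0 i ^+ 2))); last by move=> i _; ring.
  rewrite !big_split /= -!mulr_sumr sum_c sumr_const card_ord -/(diagq c x) -/q -/Sx SxE.
  rewrite (_ : _ + _ = - (n%:R + 1) * (q * (P / y))).
    have : 0 <= q * (P / y) by rewrite mulr_ge0// divr_ge0// ltW.
    by have := ler0n R n; nra.
  by rewrite /P' /P'' -mulr_natr; field; rewrite gt_eqF.
- have -> : \sum_(i < n) (P * (2 * c i * x 0 i) + q * (P' * (2 * x 0 i))) ^+ 2
      = 4 - 3 * (q / y) ^+ 2.
    rewrite (eq_bigr (fun i => (4 * P ^+ 2 + q ^+ 2 * P' ^+ 2 * 4) * (1 * x 0 i ^+ 2)
      + (8 * P * P' * q) * (c i * x 0 i ^+ 2))); last first.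
      move=> i _; transitivity ((4 * P ^+ 2 * c i ^+ 2 + q ^+ 2 * P' ^+ 2 * 4)
        * (1 * x 0 i ^+ 2) + (8 * P * P' * q) * (c i * x 0 i ^+ 2)); first by ring.
      by rewrite c2 mulr1.
    rewrite big_split /= -!mulr_sumr -/(diagq (cst 1) x) -/(diagq c x) -/y -/q /P'.
    transitivity ((4 * y^-1 + q ^+ 2 * (2^-1 ^+ 2 * (y^-1 * y^-1 ^+ 2)) * 4) * y
      + 8 * (- 2^-1 * (y^-1 / y)) * q * q).
      by rewrite -/Sx SxE -P2; ring.
    by field; rewrite gt_eqF.
  have : (q / y) ^+ 2 <= 1.
    apply: exprn_ile1; first by rewrite divr_ge0// ltW.
    by rewrite ler_pdivrMr// mul1r; apply: le_trans qy; rewrite ler_norm.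
  by lra.
Unshelve. all: by end_near. Qed.

End ConeFunction.

(** * Conormal derivatives along vertical rays *)

Section Rays.
Context {R : realType} {n : nat}.
Implicit Types (a k : R) (F w : 'rV[R]_n * R -> R) (x : 'rV[R]_n).

(* [k] is the conormal derivative of [F] at [(x, 0)], in a form that is additive. *)
Definition ray a F x k : Prop := exists F1 : R -> R,
  [/\ F (x, s) @[s --> 0^'+] --> F (x, 0),
      \forall s \near 0^'+, is_derive (s : R) 1 (fun r => F (x, r)) (F1 s)
    & s `^ a * F1 s @[s --> 0^'+] --> - k].

Lemma rayD a F G x k k' : ray a F x k -> ray a G x k' ->
  ray a (fun p => F p + G p) x (k + k').
Proof.
move=> [F1 [F0 dF lF]] [G1 [G0 dG lG]]; exists (fun s => F1 s + G1 s); split.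
- exact: cvgD.
- near=> s; have H1 : is_derive (s : R) 1 (fun r => F (x, r)) (F1 s).
    by near: s; exact: dF.
  have H2 : is_derive (s : R) 1 (fun r => G (x, r)) (G1 s) by near: s; exact: dG.
  exact: is_deriveD H1 H2.
- rewrite opprD; apply: cvg_trans (cvgD lF lG); apply: near_eq_cvg.
  by near=> s; rewrite mulrDr.
Unshelve. all: by end_near. Qed.

Lemma rayZ a F x k c : ray a F x k -> ray a (fun p => c * F p) x (c * k).
Proof.
move=> [F1 [F0 dF lF]]; exists (fun s => c * F1 s); split.
- by apply: cvgM => //; exact: cvg_cst.
- near=> s; have H1 : is_derive (s : R) 1 (fun r => F (x, r)) (F1 s).
    by near: s; exact: dF.
  exact: is_deriveZ.
- rewrite -mulrN.
  have H : c * (s `^ a * F1 s) @[s --> 0^'+] --> c * - k.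
    by apply: cvgM => //; exact: cvg_cst.
  by apply: cvg_trans H; apply: near_eq_cvg; near=> s; rewrite mulrCA.
Unshelve. all: by end_near. Qed.

Lemma ray_cst a x k : ray a (cst k) x 0.
Proof.
exists (cst 0); split; first exact: cvg_cst.
- by near=> s; exact: is_derive_cst.
- rewrite oppr0 (_ : (fun _ => _) = cst 0); first exact: cvg_cst.
  by apply/funext => s; rewrite mulr0.
Unshelve. all: by end_near. Qed.

Lemma ray_profile g a (X : 'rV[R]_n -> R) k c x : 0 < g < 1 -> a = 1 - 2 * g ->
  ray a (fun p => X p.1 * profile g k c p.2) x (X x * (2 * g * k)).
Proof.
move=> g01 aE; suff H : ray a (fun p => profile g k c p.2) x (2 * g * k).
  by have [F1 [? ? ?]] := rayZ (X x) H; exists F1.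
have /andP[g0 g1] := g01.
have [p1 [dp lp]] := profile_conormal g01 aE k c; exists p1; split => //=.
- rewrite (profile0 g01).
  suff : 1 + (- k) * s `^ (2 * g) + c * s `^ 2 @[s --> 0^'+] --> 1 + (- k) * 0 + c * 0.
    by rewrite !mulr0 !addr0.
  apply: cvgD; first apply: cvgD; first exact: cvg_cst.
  + by apply: cvgM; [exact: cvg_cst|apply: powR_cvg0; lra].
  + by apply: cvgM; [exact: cvg_cst|exact: powR_cvg0].
- by near=> s; apply: dp; near: s; exact: nbhs_right_gt.
Unshelve. all: by end_near. Qed.

Lemma ray_max a F x k : ray a F x k ->
  (\forall s \near 0^'+, F (x, s) <= F (x, 0)) -> 0 <= k.
Proof.
move=> [F1 [F0 dF lF]] Fmax; rewrite -oppr_le0.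
exact: (@conormal_local_max _ a _ (fun s => F (x, s)) F1).
Qed.

Lemma cvg_ray (x : 'rV[R]_n) : (x, s) @[s --> (0 : R)^'+] --> (x, 0 : R).
Proof.
apply: (@cvg_pair _ _ _ _ (nbhs x) (nbhs (0:R))); first exact: cvg_cst.
by apply: cvg_at_right_filter; exact: cvg_id.
Qed.

Lemma cvg_ray_within (T : set ('rV[R]_n * R)) F x : {within T, continuous F} ->
  T (x, 0) -> (\forall s \near 0^'+, T (x, s)) ->
  F (x, s) @[s --> 0^'+] --> F (x, 0).
Proof.
move=> /subspace_continuousP cF Tx nT.
move=> B /(cF _ Tx) nB.
have {}nB := cvg_ray nB.
suff : \forall s \near 0^'+, B (F (x, s)) by [].
near=> s; have Ts : T (x, s) by near: s; exact: nT.
have : T (x, s) -> B (F (x, s)) by near: s; exact: nB.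
exact.
Unshelve. all: by end_near. Qed.

(** [conormal] is a [lim], informative only when the limit exists; existence comes from the
    continuous extension of the weighted derivative to the closure, evaluated at [(x, 0)]. *)
Lemma ray_classical a D w x : classical_reg a D w ->
  (\forall s \near 0^'+, D (x, s)) -> ray a w x (conormal a w x).
Proof.
move=> [wC2 cw [h [ch hE]]] nD.
have nclD : \forall s \near 0^'+, closure D (x, s).
  by apply: filterS nD => s; exact: subset_closure.
have clD : closure D (x, 0).
  move=> B /cvg_ray nB.
  by near (0 : R)^'+ => s; exists (x, s); split; near: s; [exact: nD|exact: nB].
have lh : s `^ a * dlam w (x, s) @[s --> 0^'+] --> h (x, 0).
  have := @cvg_ray_within _ _ _ ch clD nclD; apply: cvg_trans; apply: near_eq_cvg.
  by near=> s; apply: hE; near: s; exact: nD.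
exists (fun s => dlam w (x, s)); split.
- exact: cvg_ray_within cw clD nclD.
- near=> s; apply: (@is_derive_line _ _ w (fun s => (x, s)) s (0, 1)).
    move=> r; apply: injective_projections => /=; first by rewrite scaler0 add0r.
    by rewrite /GRing.scale/= mulr1.
  have Ds : D (x, s) by near: s; exact: nD.
  by have [_ /(_ (0, 1))[]] := wC2 _ Ds.
- by rewrite /conormal opprK (cvg_lim _ lh).
Unshelve. all: by end_near. Qed.

End Rays.

(** * Closed superlevel sets and compact cylinders *)

Section Topology.
Context {R : realType}.

Lemma near_fst_snd n (P : 'rV[R]_n -> Prop) (Q : R -> Prop)
    (x : 'rV[R]_n) (l : R) :
  (\forall y \near x, P y) -> (\forall s \near l, Q s) ->
  \forall q \near (x, l), P q.1 /\ Q q.2.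
Proof. by move=> nP nQ; exists (P, Q). Qed.

Lemma closed_within_ge (T : topologicalType) (C : set T) (v : T -> R) c :
  closed C -> {within C, continuous v} -> closed (C `&` [set p | c <= v p]).
Proof.
move=> cC /subspace_continuousP cv p pS.
have Cp : C p by apply: cC => B /pS[q [[]]]; exists q.
split => //=; rewrite leNgt; apply/negP => vpc.
have := cv _ Cp [set r | r < c].
have : nbhs (v p) [set r | r < c] by exact: lt_nbhsl.
move=> /[swap] /[apply]; rewrite nbhs_simpl /= => /pS[q [[Cq cq] /(_ Cq)]] /=.
by rewrite ltNge cq.
Qed.

Lemma diagq_continuous n (c : 'I_n -> R) : continuous (diagq c).
Proof.
suff H (s : seq 'I_n) :
  continuous (fun y : 'rV[R]_n => \sum_(i <- s) c i * y 0 i ^+ 2) by exact: H.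
elim: s => [|i s IH].
  by under eq_fun do rewrite big_nil; exact: cst_continuous.
under eq_fun do rewrite big_cons; move=> x.
apply: (@cvgD _ _ _ (nbhs x)); last exact: IH.
apply: (@cvgM _ _ (nbhs x)); first exact: cvg_cst.
by apply: (@cvgM _ _ (nbhs x)); exact: coord_continuous.
Qed.

Lemma diagq_sub_continuous n (c : 'I_n -> R) (y : 'rV[R]_n) :
  continuous (fun x : 'rV[R]_n => diagq c (x - y)).
Proof.
move=> x; apply: (@continuous_comp _ _ _ (fun x : 'rV[R]_n => x - y)).
  by apply: (@cvgB _ _ _ (nbhs x)); [exact: cvg_id|exact: cvg_cst].
exact: diagq_continuous.
Qed.

Lemma compact_cylinder n (y : 'rV[R]_n) C H :
  compact [set p : 'rV[R]_n * R | diagq (cst 1) (p.1 - y) <= C /\ 0 <= p.2 <= H].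
Proof.
have -> : [set p : 'rV[R]_n * R | diagq (cst 1) (p.1 - y) <= C /\ 0 <= p.2 <= H]
    = [set x | diagq (cst 1) (x - y) <= C] `*` `[0, H].
  by apply/seteqP; split => -[x l] /=; rewrite in_itv.
apply: compact_setX; last exact: segment_compact.
(* The half-width [C + 1] bounds [|r|] whenever [r ^ 2 <= C], by [2 * |r| <= r ^ 2 + 1], without a
   square root. *)
have box : compact [set v : 'rV[R]_n | forall i,
    `[y 0 i - (C + 1), y 0 i + (C + 1)]%classic (v ord0 i)].
  apply: (@rV_compact _ _
    (fun i => `[y 0 i - (C + 1), y 0 i + (C + 1)]%classic)) => i.
  exact: segment_compact.
apply: (subclosed_compact _ box).
  have := @preimage_closed _ _ _ [set r : R | r <= C] 
    (fun x _ => @diagq_sub_continuous _ (cst 1) y x).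
  by apply; exact: closed_le.
move=> x /= xC i; rewrite /= in_itv /=.
have xi : (x 0 i - y 0 i) ^+ 2 <= C.
  apply: le_trans xC; rewrite /diagq (bigD1 i) //= !mxE mul1r lerDl.
  by apply: sumr_ge0 => j _; rewrite mul1r sqr_ge0.
have -> : x ord0 i = x 0 i by [].
have := sqr_ge0 (x 0 i - y 0 i - 1); have := sqr_ge0 (x 0 i - y 0 i + 1).
by move=> H1 H2; apply/andP; split; nra.
Qed.

End Topology.

(** * Lower bound for the solution away from the Simons cone *)

Section Nonlinearity.
Context {R : realType} (f : R -> R).
Hypotheses (df : forall x, x \in `]-1, 1[ ->
     derivable f x 1 /\ derivable (derive1 f) x 1)
  (f0 : f 0 = 0) (f1 : f x @[x --> 1^'-] --> (0 : R))
  (f2 : forall x, x \in `]0, 1[ -> derive1n 2 f x < 0).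

Let cont_derivable (h : R -> R) x : derivable h x 1 -> {for x, continuous h}.
Proof. by move=> H; apply: differentiable_continuous; exact/derivable1_diffP. Qed.

Let mvt (h : R -> R) x y : x < y ->
  (forall z, x <= z <= y -> derivable h z 1) ->
  exists2 c, x < c < y & h y - h x = derive1 h c * (y - x).
Proof.
move=> xy dh; have [||c] := @MVT _ h (derive1 h) x y xy.
- move=> z; rewrite in_itv /= => /andP[xz zy]; rewrite derive1E.
  by apply: derivableP; apply: dh; rewrite !ltW.
- apply: continuous_in_subspaceT => z; rewrite inE /= in_itv /= => xzy.
  by apply: cont_derivable; exact: dh.
by rewrite in_itv /=; exists c.
Qed.

Let der x : 0 <= x < 1 -> derivable f x 1 /\ derivable (derive1 f) x 1.
Proof. by move=> /andP[x0 x1]; apply: df; rewrite in_itv /= x1 andbT; lra. Qed.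

Lemma derive1_decr x y : 0 <= x -> x < y -> y < 1 -> derive1 f y < derive1 f x.
Proof.
move=> x0 xy y1; have [|c /andP[xc cy] E] := @mvt (derive1 f) x y xy.
  by move=> z /andP[xz zy]; apply: (der _).2; apply/andP; split; lra.
rewrite -subr_lt0 E nmulr_rlt0 ?subr_gt0//.
have := @f2 c; rewrite /derive1n /= in_itv /=; apply.
by apply/andP; split; lra.
Qed.

Lemma derive1_le0 x : 0 < x < 1 -> derive1 f x <= derive1 f 0.
Proof. by move=> /andP[x0 x1]; apply/ltW/derive1_decr. Qed.

Lemma secant x y : 0 <= x -> x < y -> y < 1 ->
  exists2 c, x < c < y & f y - f x = derive1 f c * (y - x).
Proof.
move=> x0 xy y1; apply: mvt => // z /andP[xz zy].
by apply: (der _).1; apply/andP; split; lra.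
Qed.

(** Otherwise [f'] is negative on (0,1) by concavity, so [f] falls below 0 at 1/2 and keeps
    decreasing, against its limit 0 at 1. *)
Lemma derive1_0_gt0 : 0 < derive1 f 0.
Proof.
rewrite ltNge; apply/negP => d0.
have neg c : 0 < c -> c < 1 -> derive1 f c < 0.
  by move=> c0 c1; apply: lt_le_trans d0; exact: derive1_decr.
have h20 : 0 < 2^-1 :> R by lra.
have h21 : 2^-1 < 1 :> R by lra.
have fh : f 2^-1 < 0.
  have [c /andP[c0 c1]] := secant (lexx 0) h20 h21.
  by rewrite f0 !subr0 => ->; rewrite nmulr_rlt0// neg//; lra.
suff : 0 <= f 2^-1 by rewrite leNgt fh.
apply: (cvgr_to_le f1); near=> y.
have y2 : 2^-1 < y by near: y; exact: nbhs_left_gt.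
have y1 : y < 1 by near: y; exact: nbhs_left_lt.
have [|c /andP[c0 c1] E] := secant _ y2 y1; first lra.
by rewrite -subr_le0 E nmulr_rle0 ?subr_ge0 ?ltW// neg//; lra.
Unshelve. all: by end_near. Qed.

Lemma concave_gap x : 0 < x < 1 -> 0 < f x - derive1 f x * x.
Proof.
move=> /andP[x0 x1]; have [c /andP[c0 cx]] := secant (lexx 0) x0 x1.
rewrite f0 !subr0 => ->; rewrite -mulrBl mulr_gt0// subr_gt0.
exact: derive1_decr (ltW c0) cx x1.
Qed.

(** The derivative of [f x - f'(x) * x] is [- x * f''(x) > 0]. Monotonicity turns a lower bound on
    [u] into a uniform lower bound on the gap. *)
Lemma concave_gap_incr x y : 0 < x -> x <= y -> y < 1 ->
  f x - derive1 f x * x <= f y - derive1 f y * y.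
Proof.
move=> x0; rewrite le_eqVlt => /predU1P[-> //|xy] y1.
have [c /andP[xc cy] E] := secant (ltW x0) xy y1.
have c0 : 0 < c by lra.
have := derive1_decr (ltW c0) cy y1; have := derive1_decr (ltW x0) xy y1.
rewrite -subr_gt0 => H1; rewrite -subr_gt0 => H2.
have xy0 : 0 < y - x by lra.
have := mulr_gt0 H1 x0; have := mulr_gt0 H2 xy0.
by move: E; set A := derive1 f c; set B := derive1 f x; set D := derive1 f y; nra.
Qed.

Lemma half_slope : exists2 s0, 0 < s0 < 1 &
  forall s, 0 < s < s0 -> derive1 f 0 / 2 * s < f s.
Proof.
have m0 := derive1_0_gt0.
have c0 : {for 0, continuous (derive1 f)}.
  by apply: cont_derivable; apply: (der _).2; rewrite lexx ltr01.
have : \forall x \near 0, derive1 f 0 / 2 < derive1 f x.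
  by apply: (cvgr_gt _ c0); lra.
move=> /near_itv[e e0 eP]; exists (Num.min e 2^-1).
  by rewrite lt_min e0 /= gt_min orbC invf_lt1 ?ltr1n ?invr_gt0 ?ltr0n.
move=> s; rewrite lt_min => /andP[s0 /andP[se s2]].
have s1 : s < 1 by apply: lt_trans s2 _; lra.
have [c /andP[c0' cs]] := secant (lexx 0) s0 s1.
by rewrite f0 !subr0 => ->; rewrite ltr_pM2r// eP//; lra.
Qed.

End Nonlinearity.

Section EuclideanNorm.
Context {R : realType} {n : nat}.
Implicit Types x y : 'rV[R]_n.

Lemma diagq1 x : diagq (cst 1) x = \sum_(i < n) x 0 i ^+ 2.
Proof. by apply: eq_bigr => i _; rewrite mul1r. Qed.

Lemma cauchy_schwarz x y :
  (\sum_(i < n) x 0 i * y 0 i) ^+ 2 <= diagq (cst 1) x * diagq (cst 1) y.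
Proof.
set A := diagq (cst 1) x; set C := diagq (cst 1) y; set B := \sum_(i < n) _.
have C0 : 0 <= C by apply: diagq_ge0 => i; exact: ler01.
have : 0 <= \sum_(i < n) (C * x 0 i - B * y 0 i) ^+ 2.
  by apply: sumr_ge0 => i _; exact: sqr_ge0.
rewrite (eq_bigr (fun i => C ^+ 2 * x 0 i ^+ 2 + (- 2 * C * B) * (x 0 i * y 0 i)
  + B ^+ 2 * y 0 i ^+ 2)); last by move=> i _; ring.
rewrite !big_split /= -!mulr_sumr -!diagq1 -/A -/B -/C.
move: C0; rewrite le_eqVlt => /predU1P[C0 _|C0].
  have y0 i : y 0 i = 0.
    have /eqP := esym C0; rewrite /C /diagq psumr_eq0; last first.
      by move=> j _; rewrite mul1r sqr_ge0.
    by move=> /allP/(_ i); rewrite mem_index_enum mul1r sqrf_eq0 => /(_ isT)/eqP.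
  by rewrite -C0 mulr0 /B big1 ?expr0n// => i _; rewrite y0 mulr0.
rewrite (_ : _ + _ = C * (A * C - B ^+ 2)); last by ring.
by rewrite pmulr_rge0// subr_ge0.
Qed.

Lemma enorm_triangle x y : enorm (x + y) <= enorm x + enorm y.
Proof.
have := enorm_ge0 x; have := enorm_ge0 y; move=> y0 x0.
rewrite -ler_sqr ?nnegrE ?addr_ge0 ?enorm_ge0// sqrrD !sqr_enorm.
rewrite {1}diagq1 (eq_bigr (fun i => x 0 i ^+ 2 + 2 * (x 0 i * y 0 i)
  + y 0 i ^+ 2)); last by move=> i _; rewrite mxE; ring.
rewrite !big_split /= -!mulr_sumr -!diagq1.
rewrite lerD2r lerD2l -[leRHS]mulr_natl ler_pM2l//.
apply: le_trans (ler_norm _) _.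
rewrite -ler_sqr ?nnegrE ?mulr_ge0// real_normK ?num_real// exprMn !sqr_enorm.
exact: cauchy_schwarz.
Qed.

Lemma enormZ k x : enorm (k *: x) = `|k| * enorm x.
Proof.
rewrite /enorm -sqrtr_sqr -sqrtrM ?sqr_ge0// mulr_sumr; congr Num.sqrt.
by apply: eq_bigr => i _; rewrite mxE exprMn.
Qed.

End EuclideanNorm.

(** * Geometry of the Simons cone *)

Section SimonsCone.
Context {R : realType} {m : nat}.
Implicit Types x y : 'rV[R]_(m + m).

Definition simons (i : 'I_(m + m)) : R := if (i < m)%N then 1 else - 1.

Lemma simons2 i : simons i ^+ 2 = 1.
Proof. by rewrite /simons; case: ifP => _; rewrite ?expr1n ?sqrrN ?expr1n. Qed.

Lemma sum_simons : \sum_(i < m + m) simons i = 0.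
Proof.
rewrite big_split_ord /= (eq_bigr (fun=> 1)); last by move=> i _; rewrite /simons /= ltn_ord.
rewrite [X in _ + X](eq_bigr (fun=> - 1)); last first.
  by move=> i _; rewrite /simons /= ltnNge leq_addr.
by rewrite sumrN subrr.
Qed.

Lemma diagq_split (c : 'I_(m + m) -> R) k l x :
  (forall i, c (lshift m i) = k) -> (forall i, c (rshift m i) = l) ->
  diagq c x = k * srad x ^+ 2 + l * trad x ^+ 2.
Proof.
move=> ck cl; rewrite /srad /trad !sqr_enorm /diagq big_split_ord /= !mulr_sumr.
by congr (_ + _); apply: eq_bigr => i _; rewrite ?ck ?cl mxE mul1r.
Qed.

Lemma diagq1_split x : diagq (cst 1) x = srad x ^+ 2 + trad x ^+ 2.
Proof. by rewrite (@diagq_split _ 1 1)// !mul1r. Qed.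

Lemma diagq_simons x : diagq simons x = srad x ^+ 2 - trad x ^+ 2.
Proof.
rewrite (@diagq_split _ 1 (-1)) ?mul1r ?mulN1r// => i; rewrite /simons /=.
  by rewrite ltn_ord.
by rewrite ltnNge leq_addr.
Qed.

Lemma srad_ge0 x : 0 <= srad x. Proof. exact: enorm_ge0. Qed.
Lemma trad_ge0 x : 0 <= trad x. Proof. exact: enorm_ge0. Qed.

Lemma srad_continuous : continuous (@srad R m).
Proof.
rewrite (_ : @srad R m = fun x => Num.sqrt (2^-1 * (diagq (cst 1) x + diagq simons x))).
  move=> x; apply: (@continuous_comp _ _ _
    (fun x => 2^-1 * (diagq (cst 1) x + diagq simons x)) Num.sqrt).
    apply: (@cvgM _ _ (nbhs x)); first exact: cvg_cst.
    by apply: (@cvgD _ _ _ (nbhs x)); exact: diagq_continuous.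
  exact: sqrt_continuous.
apply/funext => x; rewrite diagq1_split diagq_simons.
rewrite (_ : _ * _ = srad x ^+ 2); last by field.
rewrite sqrtr_sqr ger0_norm//.
exact: srad_ge0.
Qed.

Lemma trad_continuous : continuous (@trad R m).
Proof.
rewrite (_ : @trad R m = fun x => Num.sqrt (2^-1 * (diagq (cst 1) x - diagq simons x))).
  move=> x; apply: (@continuous_comp _ _ _
    (fun x => 2^-1 * (diagq (cst 1) x - diagq simons x)) Num.sqrt).
    apply: (@cvgM _ _ (nbhs x)); first exact: cvg_cst.
    by apply: (@cvgB _ _ _ (nbhs x)); exact: diagq_continuous.
  exact: sqrt_continuous.
apply/funext => x; rewrite diagq1_split diagq_simons.
rewrite (_ : _ * _ = trad x ^+ 2); last by field.
rewrite sqrtr_sqr ger0_norm//.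
exact: trad_ge0.
Qed.

(** The distance from [y] to the cone is [(s - t) / sqrt 2], so radii are written [sqrt 2 * r]. By
    the triangle inequality in each block, [s - t] drops by at most [p + q <= sqrt (2 * (p ^ 2 + q ^
    2)) <= 2 * r]. *)
Lemma ball_calO y r x : 0 <= r -> 2 * r < srad y - trad y ->
  diagq (cst 1) (x - y) <= 2 * r ^+ 2 -> calO x.
Proof.
move=> r0 ry; rewrite diagq1_split /calO /=.
have := srad_ge0 (x - y); have := trad_ge0 (x - y).
have H1 : srad y <= srad x + srad (x - y).
  have := enorm_triangle (lsubmx x) (- lsubmx (x - y)).
  rewrite -scaleN1r enormZ normrN1 mul1r scaleN1r /srad; apply: le_trans.
  rewrite (_ : lsubmx x - _ = lsubmx y)//.
  by rewrite linearB /= opprB addrC subrK.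
have H2 : trad x <= trad y + trad (x - y).
  have := enorm_triangle (rsubmx y) (rsubmx (x - y)).
  rewrite (_ : rsubmx y + _ = rsubmx x)//.
  by rewrite linearB /= addrC subrK.
set p := srad (x - y) in H1 *; set q := trad (x - y) in H2 *.
move=> q0 p0 pq.
suff : p + q <= 2 * r by move=> pqr; lra.
rewrite -ler_sqr ?nnegrE ?addr_ge0 ?mulr_ge0//.
by have := sqr_ge0 (p - q); nra.
Qed.

(** In the [(s, t)] quadrant this is a move in direction (1,-1), normal to the cone, realized by
    rescaling the two blocks of [x]. *)
Lemma shift_from_cone x t : 0 <= t -> t <= trad x -> 0 < trad x -> 0 < srad x ->
  exists y, [/\ srad y = srad x + t, trad y = trad x - t
    & diagq (cst 1) (x - y) = 2 * t ^+ 2].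
Proof.
move=> t0 tx x0 s0.
exists (row_mx ((1 + t / srad x) *: lsubmx x) ((1 - t / trad x) *: rsubmx x)).
rewrite diagq1_split /srad /trad !(row_mxKl, row_mxKr, linearB) /=.
rewrite !(row_mxKl, row_mxKr) !enormZ -/(srad x) -/(trad x).
have st : 0 <= t / srad x by rewrite divr_ge0// ltW.
have tt : t / trad x <= 1 by rewrite ler_pdivrMr ?mul1r.
split.
- by rewrite ger0_norm; [field; rewrite gt_eqF|lra].
- by rewrite ger0_norm; [field; rewrite gt_eqF|lra].
- rewrite -[X in X - _ *: lsubmx x]scale1r -[X in X - _ *: rsubmx x]scale1r.
  rewrite -!scalerBl !enormZ -/(srad x) -/(trad x) !exprMn !real_normK ?num_real//.
  by field; rewrite !gt_eqF.
Qed.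

Lemma conefun_le x : calO x -> conefun simons x <= 2 * (srad x - trad x).
Proof.
rewrite /calO /= /conefun diagq_simons diagq1_split => ts.
have := srad_ge0 x; have := trad_ge0 x; move: ts.
set s := srad x; set t := trad x => ts t0 s0.
have s_gt0 : 0 < s by lra.
have y0 : 0 < s ^+ 2 + t ^+ 2 by rewrite ltr_pwDl ?sqr_ge0// exprn_gt0.
rewrite powRN (powR12_sqrt (ltW y0)) ler_pdivrMr ?sqrtr_gt0//.
rewrite subr_sqr -mulrA mulrCA ler_pM2l ?subr_gt0//.
rewrite -ler_sqr ?nnegrE ?mulr_ge0 ?sqrtr_ge0 ?addr_ge0// exprMn (sqr_sqrtr (ltW y0)).
by have := sqr_ge0 (s - t); nra.
Qed.

Lemma calO_diagq x : calO x -> [/\ 0 < diagq (cst 1) x, 0 <= diagq simons x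
  & `|diagq simons x| <= diagq (cst 1) x].
Proof.
rewrite /calO /= diagq1_split diagq_simons => ts.
have := srad_ge0 x; have := trad_ge0 x; move: ts.
set s := srad x; set t := trad x => ts t0 s0.
have s_gt0 : 0 < s by lra.
have q0 : 0 <= s ^+ 2 - t ^+ 2 by rewrite subr_ge0 ler_sqr ?nnegrE// ltW.
split => //; first by rewrite ltr_pwDl ?sqr_ge0// exprn_gt0.
by rewrite ger0_norm//; have := sqr_ge0 t; lra.
Qed.

End SimonsCone.

(** * Continuity up to the bottom of the half-space *)

Section ClosedHalfspace.
Context {R : realType} {n : nat}.

Definition chalf : set ('rV[R]_n * R) := [set p | 0 <= p.2].

Lemma closure_halfspace : closure (@halfspace R n) = chalf.
Proof.
apply/seteqP; split => -[x l].
  move=> cl; rewrite /chalf /= leNgt; apply/negP => l0.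
  have : nbhs (x, l) [set q : 'rV[R]_n * R | q.2 < 0].
    exact: (@cvg_snd _ _ (nbhs x) (nbhs l) _ _ (lt_nbhsl l0)).
  by move=> /cl[q [/= q0 q1]]; have := lt_trans q0 q1; rewrite ltxx.
rewrite /chalf /= => l0 B nB.
have cv : (x, l + s) @[s --> (0 : R)^'+] --> (x, l).
  apply: (@cvg_pair _ _ _ _ (nbhs x) (nbhs l)); first exact: cvg_cst.
  suff : l + s @[s --> (0 : R)^'+] --> l + 0 by rewrite addr0.
  by apply: cvgD; [exact: cvg_cst|apply: cvg_at_right_filter; exact: cvg_id].
near (0 : R)^'+ => s; exists (x, l + s); split => /=.
  rewrite /halfspace /=; apply: ltr_wpDl => //; near: s; exact: nbhs_right_gt.
by near: s; exact: cv.
Unshelve. all: by end_near. Qed.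

Lemma open_halfspace : open (@halfspace R n).
Proof.
have : open ((snd : 'rV[R]_n * R -> R) @^-1` [set r | 0 < r]).
  by apply: open_comp; [move=> ? _; exact: cvg_snd|exact: open_gt].
by [].
Qed.

(** At 0 the limit is taken within nonnegative reals, since [powR] is not a meaningful power on the
    negative side. *)
Lemma cvg_powR_within (k l : R) : 0 < k -> 0 <= l ->
  r `^ k @[r --> within [set r : R | 0 <= r] (nbhs l)] --> l `^ k.
Proof.
move=> k0; rewrite le_eqVlt => /predU1P[<-|l0]; last first.
  apply: cvg_within_filter.
  have : {for l, continuous (@powR R ^~ k)}.
    apply: differentiable_continuous; apply/derivable1_diffP.
    by apply: derivable_powR; rewrite in_itv /= l0.
  exact.
rewrite powR0 ?gt_eqF// => B nB.
have /= := powR_cvg0 k0 nB.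
suff H : (\forall r \near (0 : R), 0 < r -> B (r `^ k)) ->
   \forall r \near (0 : R), 0 <= r -> B (r `^ k) by exact: H.
apply: filterS => r Br; rewrite le_eqVlt => /predU1P[<-|/Br//].
by rewrite powR0 ?gt_eqF//; exact: nbhs_singleton.
Qed.

Lemma cvg_snd_within (p : 'rV[R]_n * R) : q.2 @[q --> within chalf (nbhs p)]
  --> within [set r : R | 0 <= r] (nbhs p.2).
Proof.
move=> B nB.
have : nbhs p ((snd : 'rV[R]_n * R -> R) @^-1` [set r | 0 <= r -> B r]).
  exact: (@cvg_snd _ _ (nbhs p.1) (nbhs p.2)).
by apply: filterS => q qB q0; exact: qB.
Qed.

Lemma continuous_powR_chalf k : 0 < k ->
  {within chalf, continuous (fun p : 'rV[R]_n * R => p.2 `^ k)}.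
Proof.
move=> k0; apply/subspace_continuousP => p p0.
by move=> B nB; exact: (cvg_snd_within (cvg_powR_within k0 p0 nB)).
Qed.

Lemma continuous_profile_chalf g k c : 0 < g ->
  {within chalf, continuous (fun p : 'rV[R]_n * R => profile g k c p.2)}.
Proof.
move=> g0; apply/subspace_continuousP => p p0.
have g2 : 0 < 2 * g by rewrite mulr_gt0.
have /subspace_continuousP/(_ p p0) H1 := continuous_powR_chalf g2.
have /subspace_continuousP/(_ p p0) H2 := continuous_powR_chalf (ltr0n R 2).
by apply: cvgD; [apply: cvgD|]; do ?[exact: cvg_cst|apply: cvgM].
Qed.

Lemma continuous_fst_within (S : set ('rV[R]_n * R)) (X : 'rV[R]_n -> R) :
  (forall p, S p -> {for p.1, continuous X}) ->
  {within S, continuous (fun p : 'rV[R]_n * R => X p.1)}.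
Proof.
move=> cX; apply/subspace_continuousP => p Sp; apply: cvg_within_filter.
by move=> B nB; exact: (@cvg_fst _ _ (nbhs p.1) (nbhs p.2) _ _ (cX p Sp B nB)).
Qed.

Lemma continuous_barrier g : 0 < g -> {within chalf, continuous (@barrier R n g)}.
Proof.
move=> g0; apply/subspace_continuousP => p p0.
have /subspace_continuousP/(_ p p0) H1 := continuous_powR_chalf g0.
have /subspace_continuousP/(_ p p0) H2 := continuous_powR_chalf (ltr0n R 2).
have /subspace_continuousP/(_ p p0) H3 : {within chalf, continuous
    (fun p : 'rV[R]_n * R => diagq (cst 1) p.1)}.
  by apply: continuous_fst_within => q _; exact: diagq_continuous.
apply: cvgD; last by apply: cvgM => //; exact: cvg_cst.
have q0 : 0 <= diagq (cst 1) p.1 by apply: diagq_ge0 => i; exact: ler01.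
have c1 : 1 + diagq (cst 1) q.1 + q.2 `^ 2 @[q --> within chalf (nbhs p)]
    --> 1 + diagq (cst 1) p.1 + p.2 `^ 2.
  by apply: cvgD => //; apply: cvgD => //; exact: cvg_cst.
have c2 : {for 1 + diagq (cst 1) p.1 + p.2 `^ 2, continuous (@ln R)}.
  by apply: continuous_ln; rewrite ltr_wpDr ?powR_ge0// ltr_wpDr.
by move=> B nB; exact: (c1 _ (c2 B nB)).
Qed.

End ClosedHalfspace.

Section ExtensionSolution.
Context {R : realType} {n : nat} (a d : R) (f : R -> R) (u : 'rV[R]_n * R -> R).
Hypothesis hu : extension_solution a d f u.

Lemma solution_continuous : {within chalf, continuous u}.
Proof. by have [[_ + _] _ _] := hu; rewrite closure_halfspace. Qed.

Lemma solution_ray x : ray a u x (conormal a u x).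
Proof.
have [H _ _] := hu; apply: ray_classical H _.
by near=> s; rewrite /halfspace /=; near: s; exact: nbhs_right_gt.
Unshelve. all: by end_near. Qed.

Lemma solution_wdiv p : 0 < p.2 -> wdiv a u p 0.
Proof.
have [[H _ _] div0 _] := hu; move=> p0.
by have := wdiv_C2 a (@open_halfspace R n) H p0 p0; rewrite div0.
Qed.

End ExtensionSolution.

Section WithinContinuous.
Context {R : realType} {T : topologicalType} (S : set T).
Implicit Types F G : T -> R.

Lemma within_continuousD F G : {within S, continuous F} ->
  {within S, continuous G} -> {within S, continuous (fun p => F p + G p)}.
Proof. by move=> cF cG p; apply: cvgD; [exact: cF|exact: cG]. Qed.

Lemma within_continuousN F : {within S, continuous F} ->
  {within S, continuous (fun p => - F p)}.
Proof. by move=> cF p; apply: cvgN; exact: cF. Qed.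

Lemma within_continuous_cst (k : R) : {within S, continuous (fun=> k)}.
Proof. by move=> p; exact: cvg_cst. Qed.

Lemma within_continuousM F G : {within S, continuous F} ->
  {within S, continuous G} -> {within S, continuous (fun p => F p * G p)}.
Proof. by move=> cF cG p; apply: cvgM; [exact: cF|exact: cG]. Qed.

Lemma within_continuous_min F G : {within S, continuous F} ->
  {within S, continuous G} -> {within S, continuous (fun p => Num.min (F p) (G p))}.
Proof. by move=> cF cG p; apply: continuous_min; [exact: cF|exact: cG]. Qed.

Lemma within_continuousV F : (forall p, S p -> F p != 0) ->
  {within S, continuous F} -> {within S, continuous (fun p => (F p)^-1)}.
Proof.
move=> F0 /subspace_continuousP cF; apply/subspace_continuousP => p Sp.
by apply: cvgV; [exact: F0|exact: cF].
Qed.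

End WithinContinuous.

Lemma sqbump_continuous {R : realType} {n : nat} C (y : 'rV[R]_n) :
  continuous (sqbump C y).
Proof.
move=> x; have cz : C - diagq (cst 1) (z - y) @[z --> x] --> C - diagq (cst 1) (x - y).
  apply: (@cvgB _ _ _ (nbhs x)); first exact: cvg_cst.
  exact: diagq_sub_continuous.
exact: (cvgM cz cz).
Qed.

Section BallLowerBound.
Context {R : realType} {n : nat} (g a d : R) (f : R -> R) (u : 'rV[R]_n * R -> R).
Variables (mu s0 : R) (D : set 'rV[R]_n).
Hypotheses (g01 : 0 < g < 1) (aE : a = 1 - 2 * g) (d0 : 0 < d)
  (hu : extension_solution a d f u) (mu0 : 0 < mu) (s0_gt0 : 0 < s0)
  (hf : forall s, 0 < s < s0 -> mu / 2 * s < f s)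
  (u_gt0 : forall x l, D x -> 0 <= l -> 0 < u (x, l)).

(* On a large ball the first Dirichlet eigenvalue is so small that a multiple of
   [sqbump * profile] is a subsolution lying below every positive solution. *)
Lemma ball_lower_bound : exists2 r, 0 < r & forall t, 0 <= t < r ->
  exists2 e, 0 < e & forall x y,
    (forall z, diagq (cst 1) (z - y) <= 2 * r ^+ 2 -> D z) ->
    diagq (cst 1) (x - y) <= 2 * t ^+ 2 -> e <= u (x, 0).
Proof.
have /andP[g0 g1] := g01.
have a1 : 0 < 1 + a by rewrite aE; lra.
(* Completed square for the quadratic in [q] that governs the interior divergence at the end of the
   contact argument. *)
have square (x y z t : R) :
  x * (8 * z - y * t + x * t ^+ 2) = (x * t - y / 2) ^+ 2 + (8 * (z * x) - y ^+ 2 / 4).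
  by field.
(* With this [k] the conormal term of the subsolution has slope [mu / 2], strictly below [f] for
   small values. *)
pose k := mu / (4 * g * d).
have k0 : 0 < k by rewrite divr_gt0// !mulr_gt0.
have dk : d * (2 * g * k) = mu / 2 by rewrite /k; field; rewrite !gt_eqF.
have [c [h [c0 h0 Gh Gle]]] := profile_cap g01 k0.
pose ka := c * (1 + a); have ka0 : 0 < ka by rewrite mulr_gt0.
pose b : R := 4 * n%:R + 8.
have b0 : 0 < b by rewrite /b; have := ler0n R n; lra.
(* The radius is taken large enough that [b ^ 2 <= C * ka], so that [8 * C - b * q + ka * q ^ 2] has
   no real root. *)
pose r := b * (1 + ka^-1); pose C := 2 * r ^+ 2.
have r0 : 0 < r by rewrite mulr_gt0// addr_gt0// invr_gt0.
have C0 : 0 < C by rewrite mulr_gt0// exprn_gt0.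
have Cka : b ^+ 2 <= C * ka.
  rewrite (_ : C * ka = b ^+ 2 * (2 * ka + 4 + 2 * ka^-1)); last first.
    by rewrite /C /r; field; rewrite gt_eqF.
  rewrite ler_peMr ?sqr_ge0//.
  have : 0 < ka^-1 by rewrite invr_gt0.
  by lra.
exists r => // t /andP[t0 tr].
have tC : 0 < C - 2 * t ^+ 2.
  by rewrite subr_gt0 /C ltr_pM2l// ltr_sqr ?nnegrE// ltW.
exists ((C - 2 * t ^+ 2) ^+ 2 * s0 / C ^+ 2).
  by apply: divr_gt0; [apply: mulr_gt0 => //|]; exact: exprn_gt0.
move=> x y BD xy.
pose Q := [set p : 'rV[R]_n * R | diagq (cst 1) (p.1 - y) <= C /\ 0 <= p.2 <= h].
have QD p : Q p -> D p.1 /\ 0 <= p.2.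
  by case=> pC /andP[p0 ph]; split => //; exact: BD.
have upos p : Q p -> 0 < u p.
  by case: p => p l /QD[/= pD l0]; exact: u_gt0.
pose w (q : 'rV[R]_n * R) := sqbump C y q.1 * profile g k c q.2.
have cw : {within Q, continuous w}.
  apply: within_continuousM.
    by apply: continuous_fst_within => q _; exact: sqbump_continuous.
  by apply: (continuous_subspaceW _ (continuous_profile_chalf g0)) => q /QD[].
have cu : {within Q, continuous u}.
  by apply: (continuous_subspaceW _ (solution_continuous hu)) => p /QD[].
have cq : {within Q, continuous (fun p => w p / u p)}.
  by apply: within_continuousM => //; apply: within_continuousV => // q /upos/lt0r_neq0.
have Qy : Q (y, 0).
  split => /=; last by rewrite lexx ltW.
  by rewrite subrr /diagq big1 ?ltW// => i _; rewrite mxE expr0n mulr0.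
have [p Qp pmax] := compact_EVT_max (ex_intro _ _ Qy) (@compact_cylinder R n y C h) cq.
rewrite inE in Qp; have up := upos _ Qp.
pose T := w p / u p.
have wT q : Q q -> w q <= T * u q.
  by move=> Qq; rewrite -ler_pdivrMr ?upos//; apply: pmax; rewrite inE.
have T0 : 0 < T.
  apply: lt_le_trans (pmax (y, 0) _); last by rewrite inE.
  rewrite divr_gt0 ?upos// /w /sqbump /= (profile0 g01) mulr1 subrr.
  by rewrite /diagq big1 ?subr0 ?exprn_gt0// => i _; rewrite mxE expr0n mulr0.
have wp : w p = T * u p by rewrite /T divfK// gt_eqF.
have wp0 : 0 < w p by rewrite wp mulr_gt0.
(* At the contact point [w] is positive, which excludes the lateral side and the top; a positive
   divergence excludes the interior. On the bottom, comparing conormal derivatives gives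
   [f u <= mu / 2 * u], hence [s0 <= u], while [w <= C ^ 2] there. *)
have TC : T <= C ^+ 2 / s0.
  clearbody T; case: p Qp up wp wp0 {pmax} =>
    z l [/= zC /andP[l0 lh]] up wp wp0.
  have b_ge0 : 0 <= sqbump C y z by exact: sqr_ge0.
  have G0 : 0 < profile g k c l.
    rewrite ltNge; apply/negP => G0; move: wp0.
    by rewrite ltNge mulr_ge0_le0.
  have bz : 0 < sqbump C y z by rewrite -(pmulr_lgt0 _ G0).
  pose q := C - diagq (cst 1) (z - y).
  have q0 : 0 < q.
    rewrite lt_def subr_ge0 zC andbT; apply/negP => /eqP q0.
    by move: bz; rewrite /sqbump -/q q0 expr0n ltxx.
  have {}lh : l < h.
    rewrite lt_def lh andbT; apply/negP => /eqP hl.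
    by move: G0; rewrite -hl Gh ltxx.
  have nz : \forall x' \near z, diagq (cst 1) (x' - y) < C.
    by apply: (cvgr_lt _ (@diagq_sub_continuous _ _ (cst 1) y z)); rewrite -subr_gt0.
  pose F (p : 'rV[R]_n * R) := w p + (- T) * u p.
  have FQ p : Q p -> F p <= F (z, l).
    by move=> /wT; rewrite /F wp !mulNr subrr subr_le0.
  move: l0; rewrite le_eqVlt => /predU1P[l0|l0].
    subst l; have rF := rayD (ray_profile (sqbump C y) k c z g01 aE)
      (rayZ (- T) (solution_ray hu z)).
    have Fz : \forall s \near 0^'+, F (z, s) <= F (z, 0).
      near=> s; apply: FQ; split => //=; apply/andP; split; apply: ltW.
        by near: s; exact: nbhs_right_gt.
      by near: s; exact: nbhs_right_lt.
    have con := ray_max rF Fz; have [_ _ fE] := hu.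
    have fT : T * f (u (z, 0)) <= sqbump C y z * (mu / 2).
      rewrite -fE -dk -subr_ge0.
      rewrite (_ : _ - _ = d * (sqbump C y z * (2 * g * k) + - T * conormal a u z)).
        by rewrite mulr_ge0// ltW.
      by ring.
    have wz : sqbump C y z = T * u (z, 0).
      by have := wp; rewrite /w /= (profile0 g01) mulr1.
    rewrite wz -mulrA ler_pM2l// in fT.
    have uz : s0 <= u (z, 0).
      rewrite leNgt; apply/negP => us0.
      by have := hf (introT andP (conj up us0)); lra.
    rewrite ler_pdivlMr//; apply: le_trans (_ : T * u (z, 0) <= _).
      by rewrite ler_pM2l.
    rewrite -wz /sqbump -/q ler_sqr ?nnegrE ?(ltW q0) ?(ltW C0)// /q lerBlDr lerDl.
    by apply: diagq_ge0 => i; exact: ler01.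
  have [dX [eX [Xd Xs]]] := sqbump_xder2 C y z.
  have [dG Gd] := profile_wder2 aE k c l0.
  have wF := wdivD (wdiv_sep Xd Gd) (wdivZ (-T) (solution_wdiv hu (l0 : 0 < (z, l).2))).
  have nQ : \forall p \near (z, l), F p <= F (z, l).
    have nl : \forall s \near l, 0 < s < h.
      by near=> s; apply/andP; split; near: s; [exact: lt_nbhsr|exact: lt_nbhsl].
    have := near_fst_snd nz nl; apply: filterS => -[x' s] /= [x'C /andP[s0' sh]].
    by apply: FQ; split => /=; rewrite ?ltW.
  have := wdiv_local_max (l0 : 0 < (z, l).2) wF nQ.
  rewrite Xs mulr0 addr0 leNgt => /negP[].
  have la : 0 < l `^ a by rewrite powR_gt0.
  rewrite (_ : _ + _ = l `^ a * (profile g k c l * (8 * C - b * q) + 2 * ka * q ^+ 2));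
    last by rewrite /ka /sqbump /b -/q; ring.
  rewrite mulr_gt0//.
  have kq : 0 < 2 * ka * q ^+ 2 by rewrite !mulr_gt0// exprn_gt0.
  (* The profile is only known to lie in (0,2]: positivity is used when the bracket is nonnegative,
     the bound 2 when it is negative. *)
  have [B0|B0] := leP 0 (8 * C - b * q).
    by rewrite ltr_wpDl// mulr_ge0// ltW.
  have GB : 2 * (8 * C - b * q) <= profile g k c l * (8 * C - b * q).
    by rewrite ler_nM2r// Gle// !ltW.
  suff : 0 < 8 * C - b * q + ka * q ^+ 2 by lra.
  rewrite -(pmulr_rgt0 _ ka0).
  have b2 : 0 < b ^+ 2 by rewrite exprn_gt0.
  have sq := sqr_ge0 (ka * q - b / 2).
  by rewrite square ltr_wpDl//; lra.
have Qx : Q (x, 0).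
  split => /=; last by rewrite lexx ltW.
  by apply: le_trans xy _; rewrite -subr_ge0 ltW.
have := wT _ Qx; rewrite {1}/w /= (profile0 g01) mulr1 => bT.
have : (C - 2 * t ^+ 2) ^+ 2 <= sqbump C y x.
  rewrite /sqbump ler_sqr ?nnegrE; [by lra|exact: ltW|].
  by rewrite subr_ge0; case: Qx.
move=> /le_trans/(_ bT) H.
have ux : 0 < u (x, 0) by exact: upos.
rewrite ler_pdivrMr ?exprn_gt0// -ler_pdivlMr//.
by apply: le_trans H _; rewrite mulrC -mulrA ler_pM2l.
Unshelve. all: by end_near. Qed.

End BallLowerBound.

Section AwayFromCone.
Context {R : realType} {m : nat} (g a d : R) (f : R -> R).
Variables (u : 'rV[R]_(m + m) * R -> R) (mu s0 : R).
Hypotheses (g01 : 0 < g < 1) (aE : a = 1 - 2 * g) (d0 : 0 < d)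
  (hu : extension_solution a d f u) (mu0 : 0 < mu) (s0_gt0 : 0 < s0)
  (hf : forall s, 0 < s < s0 -> mu / 2 * s < f s)
  (u_gt0 : forall x l, calO x -> 0 <= l -> 0 < u (x, l)).

(* Far from the origin, [x] lies well inside a ball of fixed radius contained in
   [calO], obtained by moving away from the cone along its normal; what remains is
   compact. *)
Lemma away_from_cone z : 0 < z -> exists2 e, 0 < e &
  forall x, z <= srad x - trad x -> e <= u (x, 0).
Proof.
move=> z0.
have [r r0 Hr] := ball_lower_bound g01 aE d0 hu mu0 s0_gt0 hf u_gt0.
(* Shifting by [t = r - e] raises [s - t] from at least [z] to at least [z + 2 * r - 2 * e > 2 * r],
   so the ball about the shifted center fits in [calO] and [x] lies strictly inside it. *)
pose e := Num.min (z / 4) (r / 2).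
have e0 : 0 < e by rewrite lt_min !divr_gt0.
have ez : e <= z / 4 by rewrite ge_min lexx.
have er : e <= r / 2 by rewrite ge_min lexx orbT.
pose t := r - e.
have [|e1 e1_gt0 He1] := Hr t; first by apply/andP; split; rewrite /t; lra.
(* The remaining points have [trad x < r] and [srad x - trad x <= 2 * r], hence [srad x <= 3 * r]
   and [|x|^2 <= 10 * r ^ 2]. *)
pose K := [set p : 'rV[R]_(m + m) * R |
    diagq (cst 1) (p.1 - 0) <= 10 * r ^+ 2 /\ 0 <= p.2 <= 0] `&`
  [set p | z <= srad p.1 - trad p.1].
have cS : continuous (fun x : 'rV[R]_(m + m) => srad x - trad x).
  by move=> x; apply: (@cvgB _ _ _ (nbhs x)); [exact: srad_continuous|exact: trad_continuous].
have KO p : K p -> calO p.1 /\ 0 <= p.2.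
  by case=> -[_ /andP[p0 _]] /= zp; split => //; rewrite /calO /=; lra.
have cK : compact K.
  have cC := @compact_cylinder R _ (0 : 'rV[R]_(m + m)) (10 * r ^+ 2) 0.
  apply: (subclosed_compact _ cC); last by move=> p [].
  apply: closed_within_ge.
    by apply: compact_closed cC; exact: norm_hausdorff.
  apply: (@continuous_fst_within R _ _ (fun x : 'rV[R]_(m + m) => srad x - trad x)).
    by move=> p _; exact: cS.
have [e2 e2_gt0 He2] : exists2 e2, 0 < e2 & forall p, K p -> e2 <= u p.
  have [K0|/set0P/negP/negPn/eqP K0] := pselect (K !=set0); last first.
    by exists 1 => // p; rewrite K0.
  have cu : {within K, continuous u}.
    by apply: (continuous_subspaceW _ (solution_continuous hu)) => p /KO[].
  have [p Kp pmin] := compact_EVT_min K0 cK cu.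
  rewrite inE in Kp; exists (u p); last by move=> q Kq; apply: pmin; rewrite inE.
  by case: p Kp {pmin} => x l /KO[/= xO l0]; exact: u_gt0.
exists (Num.min e1 e2); first by rewrite lt_min e1_gt0.
move=> x zx; have s_ge0 := srad_ge0 x; have t_ge0 := trad_ge0 x.
have s_gt0 : 0 < srad x by lra.
have [tr|tr] := leP r (trad x).
  have [||||y [sy ty xy]] := @shift_from_cone R m x t; rewrite /t; try lra.
  rewrite ge_min (He1 x y) ?xy// => w; apply: ball_calO; first exact: ltW.
  by rewrite sy ty /t; lra.
have [st|st] := ltP (2 * r) (srad x - trad x).
  rewrite ge_min (He1 x x)//; last first.
    rewrite subrr /diagq big1; first by apply: mulr_ge0 => //; exact: sqr_ge0.
    by move=> i _; rewrite mxE expr0n mulr0.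
  by move=> w; apply: ball_calO => //; exact: ltW.
rewrite ge_min (He2 (x, 0)) ?orbT//; split => //=; split; last by rewrite lexx.
rewrite subr0 diagq1_split.
have : srad x ^+ 2 <= (3 * r) ^+ 2 by rewrite ler_sqr ?nnegrE; lra.
have : trad x ^+ 2 <= r ^+ 2 by rewrite ler_sqr ?nnegrE; lra.
by rewrite exprMn; lra.
Qed.

End AwayFromCone.

Lemma segment_gt0 {R : realType} (x y t : R) :
  0 < x -> 0 < y -> 0 <= t -> t <= 1 -> 0 < x + t * (y - x).
Proof.
move=> x0 y0 t0 t1; have [xy|yx] := leP x y.
  by rewrite ltr_pwDl// mulr_ge0// subr_ge0.
rewrite (_ : _ + _ = y + (1 - t) * (x - y)); last by ring.
by rewrite ltr_pwDl// mulr_ge0 ?subr_ge0// ltW.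
Qed.

(** * Maximum principle in the presence of a strict supersolution *)

Section RelativeBoundary.
Context {R : realType} {n : nat} (Omega : set ('rV[R]_n * R)).
Hypotheses (oO : open Omega) (Ogt0 : forall p, Omega p -> 0 < p.2).

Lemma closure_chalf p : closure Omega p -> 0 <= p.2.
Proof.
move=> Op; suff : chalf p by [].
by rewrite -closure_halfspace; apply: closure_subset Op => q /Ogt0.
Qed.

Lemma bd_open p : closure Omega p -> ~ Omega p -> bd Omega p.
Proof. by move=> cp np; split => // /interior_subset. Qed.

(* Near a point of [bd0] the half-ball avoids [bd Omega], so being connected it lies
   in [Omega]. *)
Lemma bd0_ray p : bd0 Omega p -> p.2 = 0 /\ \forall s \near 0^'+, Omega (p.1, s).
Proof.
move=> [bp nbL]; have cp : closure Omega p by case: bp.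
have p0 : p.2 = 0.
  have := closure_chalf cp; rewrite le_eqVlt => /predU1P[//|p_gt0].
  by exfalso; apply: nbL; apply: subset_closure.
split => //; case: p p0 bp nbL cp => x l /= -> {l} bp nbL cp.
(* Not being in [bdL], a closure, the point has a neighbourhood free of boundary points with
   positive height. *)
have [U nU UB] : exists2 U, nbhs (x, 0) U &
    forall q, U q -> bd Omega q -> 0 < q.2 -> False.
  apply: contrapT => H; apply: nbL => B nB; apply: contrapT => nAB; apply: H.
  by exists B => // q Bq bq q0; apply: nAB; exists q.
have {nU} [e e0 eU] : exists2 e, 0 < e & forall q, ball x e q.1 -> ball (0 : R) e q.2 -> U q.
  move: nU => /nbhs_ballP[e /= e0 eU]; exists e => // q q1 q2.
  by apply: eU; split.
have [q0 [Oq0 [q0x q0e]]] : exists q, Omega q /\ ball x e q.1 /\ ball (0 : R) e q.2.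
  have [q0 [Oq [q1 q2]]] := cp _ (nbhsx_ballx (x, 0 : R) e e0).
  by exists q0.
near=> s.
have s0 : 0 < s by near: s; exact: nbhs_right_gt.
have se : s < e by near: s; exact: nbhs_right_lt.
pose z (t : R) : 'rV[R]_n * R := q0 + t *: ((x, s) - q0).
have z1E t : (z t).1 = q0.1 + t *: (x - q0.1) by [].
have z2E t : (z t).2 = q0.2 + t * (s - q0.2) by [].
have zU t : 0 <= t <= 1 -> U (z t) /\ 0 < (z t).2.
  move=> /andP[t0 t1]; have q0_gt0 := Ogt0 Oq0.
  move: q0e; rewrite -ball_normE /= sub0r normrN gtr0_norm// => q0e.
  split; last by rewrite /= segment_gt0.
  apply: eU.
    move: q0x; rewrite -!ball_normE /= ?z1E => q0x; apply: le_lt_trans q0x.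
    rewrite opprD addrA -[X in X - _]scale1r -scalerBl normrZ ger0_norm ?subr_ge0//.
    by rewrite ler_piMl// lerBlDr lerDl.
  have H : 0 < (e - q0.2) + t * ((e - s) - (e - q0.2)) by rewrite segment_gt0 ?subr_gt0.
  suff : ball (0 : R) e (q0.2 + t * (s - q0.2)) by [].
  by rewrite -ball_normE /= sub0r normrN gtr0_norm ?segment_gt0//; lra.
have zc : {within `[0, 1], continuous z}.
  apply: continuous_subspaceT => t; apply: (@cvgD _ _ _ (nbhs t)); first exact: cvg_cst.
  by apply: cvgZr_tmp; exact: cvg_id.
have cz := connected_continuous_connected (@segment_connected R 0 1) zc.
have zO t : 0 <= t <= 1 -> closure Omega (z t) -> Omega (z t).
  move=> /zU[Uz z_gt0] cz'; apply: contrapT => nz.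
  exact: UB Uz (bd_open cz' nz) z_gt0.
(* The part of the segment inside [Omega] is relatively open and relatively closed, and contains
   [q0], so it is the whole segment up to [(x, s)]. *)
have : (z @` `[0, 1]) `&` Omega = z @` `[0, 1].
  apply: cz; last 2 first.
  - by exists Omega.
  - exists (closure Omega); first exact: closed_closure.
    apply/seteqP; split => q [zq Oq]; split => //; first exact: subset_closure.
    by case: zq Oq => t /=; rewrite in_itv /= => t01 <-; exact: zO.
  exists q0; split => //; exists 0; first by rewrite /= in_itv /= lexx ler01.
  by rewrite /z scale0r addr0.
move=> zE; have : (z @` `[0, 1]) (x, s).
  exists 1; first by rewrite /= in_itv /= lexx ler01.
  by rewrite /z scale1r addrC subrK.
by rewrite -zE => -[].
Unshelve. all: by end_near. Qed.

End RelativeBoundary.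

Lemma limsup_at_infty_lt {R : realType} {n : nat} (S : set ('rV[R]_n * R))
    (w : 'rV[R]_n * R -> R) (c : R) : 0 < c ->
  (limsup_at_infty S w <= 0)%E ->
  exists r : R, forall p, S p -> r < enorm p.1 -> w p < c.
Proof.
move=> c0 Sw; have : (limsup_at_infty S w < c%:E)%E.
  by apply: le_lt_trans Sw _; rewrite lte_fin.
rewrite /limsup_at_infty limf_esupE => /ereal_inf_lt[_ [V [r _ rV] <-]] supV.
exists r => p Sp rp; rewrite -lte_fin; apply: le_lt_trans supV.
by apply: ereal_sup_ubound; exists p => //; apply: rV.
Qed.

Section MaximumPrinciple.
Context {R : realType} {n : nat} (g a d : R) (V : 'rV[R]_n -> R) (O : set 'rV[R]_n).
Variables (psi v b : 'rV[R]_n * R -> R) (c0 : R) (Omega : set ('rV[R]_n * R)).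
Hypotheses (g01 : 0 < g < 1) (aE : a = 1 - 2 * g) (d0 : 0 < d).

Let S : set ('rV[R]_n * R) := [set p | O p.1 /\ 0 <= p.2].

(* [psi] is a strict supersolution, in the sense that it is touched from above
   by smooth strict supersolutions. *)
Hypotheses (psi_cont : {within S, continuous psi}) (c0_gt0 : 0 < c0)
  (psi_ge : forall p, S p -> c0 <= psi p)
  (psi_super : forall p, O p.1 -> 0 < p.2 -> exists w c,
     [/\ wdiv a w p c, c <= 0, w p = psi p & \forall q \near p, psi q <= w q])
  (psi_bottom : forall x, O x -> exists w k,
     [/\ ray a w x k, V x * psi (x, 0) < d * k, w (x, 0) = psi (x, 0)
       & \forall s \near 0^'+, psi (x, s) <= w (x, s)]).

Hypotheses (oO : open Omega) (OmegaO : Omega `<=` [set p | O p.1 /\ 0 < p.2])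
  (hv : classical_reg a Omega v) (hvub : has_ubound (v @` Omega))
  (hb : forall p, Omega p -> b p <= 0)
  (hdiv : forall p, Omega p -> - div_weighted_grad a v p <= b p * v p)
  (hL : forall x, bd0 Omega (x, 0) -> d * conormal a v x - V x * v (x, 0) <= 0)
  (hbdL : forall p, bdL Omega p -> v p <= 0)
  (hlimsup : (limsup_at_infty (bd0 Omega) v <= 0)%E).

Let Ogt0 p : Omega p -> 0 < p.2. Proof. by move=> /OmegaO[]. Qed.

Let bd0_O p : bd0 Omega p -> O p.1 /\ p.2 = 0.
Proof.
move=> /(bd0_ray oO Ogt0)[p0 nO]; split => //.
near (0 : R)^'+ => s.
have : Omega (p.1, s) by near: s; exact: nO.
by move=> /OmegaO[].
Unshelve. all: by end_near. Qed.

Let positive_closure p : closure Omega p -> 0 < v p -> Omega p \/ bd0 Omega p.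
Proof.
move=> cp vp; have [|np] := pselect (Omega p); [by left|right].
split; first exact: bd_open.
by move=> /hbdL; rewrite leNgt vp.
Qed.

Let closure_Omega_cont : {within closure Omega, continuous v}.
Proof. by case: hv. Qed.

(* Phragmen-Lindelof: [barrier] is a positive strict supersolution that is
   proper on the closed half-space. *)
Lemma le_from_bottom T : 0 <= T -> (forall p, bd0 Omega p -> v p <= T * psi p) ->
  forall p, Omega p -> v p <= T * psi p.
Proof.
have /andP[g0 g1] := g01.
move=> T0 bottom p1 Op1; rewrite leNgt; apply/negP => vp1.
have [M Mub] := hvub.
have vM q : Omega q -> v q <= M by move=> Oq; apply: Mub; exists q.
pose h := @barrier R n g.
have ln_le p : 0 <= p.2 -> ln (1 + diagq (cst 1) p.1 + p.2 `^ 2) <= h p.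
  have K0 : 0 <= (2 * n%:R + 5) / g ^+ 2.
    by apply: divr_ge0; [have := ler0n R n; lra|exact: sqr_ge0].
  by move=> p0; rewrite /h /barrier lerDl mulr_ge0// powR_ge0.
have dq0 (x : 'rV[R]_n) : 0 <= diagq (cst 1) x by apply: diagq_ge0 => i; exact: ler01.
have h_ge0 p : 0 <= p.2 -> 0 <= h p.
  move=> p0; apply: le_trans (ln_le p p0).
  by apply: ln_ge0; rewrite -addrA lerDl addr_ge0// powR_ge0.
have D0 : 0 < v p1 - T * psi p1 by rewrite subr_gt0.
have h1 : 0 < h p1 + 1 by rewrite ltr_wpDl// h_ge0// ltW// Ogt0.
(* Small enough that the barrier consumes less than half of the excess at [p1], so [W p1] stays
   positive. *)
pose e := (v p1 - T * psi p1) / (2 * (h p1 + 1)).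
have e0 : 0 < e by rewrite divr_gt0// mulr_gt0.
pose W p := v p - T * psi p - e * h p.
have W1 : 0 < W p1.
  have : e * (h p1 + 1) = (v p1 - T * psi p1) / 2.
    by rewrite /e; field; rewrite gt_eqF.
  by rewrite /W; lra.
pose w1 := W p1.
have psi_ge0 p : S p -> 0 <= T * psi p.
  by move=> Sp; rewrite mulr_ge0// (le_trans _ (psi_ge Sp))// ltW.
have eh_ge0 p : S p -> 0 <= e * h p.
  by case=> _ p0; rewrite mulr_ge0 ?h_ge0// ltW.
(* Off [K], either [v < W p1] or [e * h > M >= v]; in both cases [W <= W p1], so a maximum over [K]
   is one over [Omega]. Compactness comes from the logarithm in [h]. *)
pose K := (closure Omega `&` [set p | w1 <= v p]) `&` [set p | - (M / e) <= - h p].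
have cl0 p : closure Omega p -> 0 <= p.2 by exact: closure_chalf.
have KO p : K p -> Omega p \/ bd0 Omega p.
  by move=> [[cp /= w1p] _]; apply: positive_closure => //; exact: lt_le_trans w1p.
have KS p : K p -> S p.
  by case/KO => [/OmegaO[Op /ltW p0]|/bd0_O[Op p0]]; split; rewrite ?p0.
have closedK : closed K.
  apply: closed_within_ge.
    by apply: closed_within_ge; [exact: closed_closure|exact: closure_Omega_cont].
  apply: (@continuous_subspaceW _ _ _ chalf); first by move=> p [/cl0].
  have ch := @continuous_barrier R n g g0.
  by move=> p; apply: cvgN; exact: ch.
have compK : compact K.
  pose E := expR (M / e).
  apply: (subclosed_compact closedK (@compact_cylinder R n 0 E E)).
  move=> p [[cp _] /=]; rewrite lerN2 => hM; have p0 := cl0 _ cp.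
  have S0 : 0 < 1 + diagq (cst 1) p.1 + p.2 `^ 2.
    by rewrite ltr_wpDr ?powR_ge0// ltr_wpDr.
  have : 1 + diagq (cst 1) p.1 + p.2 `^ 2 <= E.
    by rewrite -[leLHS]lnK ?posrE// ler_expR (le_trans (ln_le _ p0)).
  rewrite powR_mulrn// subr0 p0 /= => H.
  have := dq0 p.1; have := sqr_ge0 (p.2); have := sqr_ge0 (p.2 - 1).
  by move=> ? ? ?; split; nra.
have Kp1 : K p1.
  have Sp1 : S p1 by have [? /ltW] := OmegaO Op1.
  have T1 := psi_ge0 _ Sp1; have H1 := eh_ge0 _ Sp1.
  have w1E : w1 = v p1 - T * psi p1 - e * h p1 by [].
  split => /=; first by split; [exact: subset_closure|rewrite /=; lra].
  rewrite lerN2 ler_pdivlMr// mulrC.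
  by apply: le_trans (vM _ Op1); have : 0 < w1 := W1; lra.
have cW : {within K, continuous W}.
  apply: within_continuousD; last first.
    apply: within_continuousN; apply: within_continuousM; first exact: within_continuous_cst.
    by apply: (continuous_subspaceW _ (@continuous_barrier R n g g0)) => p [[/cl0]].
  apply: within_continuousD.
    by apply: (continuous_subspaceW _ closure_Omega_cont) => p [[]].
  apply: within_continuousN; apply: within_continuousM; first exact: within_continuous_cst.
  exact: continuous_subspaceW psi_cont.
have [p Kp pmax] := compact_EVT_max (ex_intro _ _ Kp1) compK cW.
rewrite inE in Kp; have Sp := KS _ Kp.
have Wp : 0 < W p by apply: lt_le_trans W1 (pmax _ _); rewrite inE.
have hp := eh_ge0 _ Sp.
have WE q : W q = v q - T * psi q - e * h q by [].
have [Op|/bottom] := KO _ Kp; last by have := WE p; lra.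
have Wmax q : Omega q -> W q <= W p.
  move=> Oq; have [Op' /ltW q0] := OmegaO Oq; have Sq : S q by [].
  have [Kq|nKq] := pselect (K q); first by apply: pmax; rewrite inE.
  have [vq|vq] := ltP (v q) w1.
    have := pmax p1; rewrite inE => /(_ Kp1) w1W.
    by have := eh_ge0 _ Sq; have := psi_ge0 _ Sq; have := WE q; have : w1 <= W p := w1W; lra.
  have hq : M / e < h q.
    rewrite ltNge; apply/negP => hq; apply: nKq; split => /=.
      by split => //; exact: subset_closure.
    by rewrite lerN2.
  move: hq; rewrite ltr_pdivrMr// mulrC => hq.
  by have := psi_ge0 _ Sq; have := vM _ Oq; have := WE q; lra.
have [Op1' p0] := OmegaO Op.
have [w [c [wc c_le0 wp nw]]] := psi_super Op1' p0.
have [ch bh ch0] := barrier_wdiv g01 aE p0.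
have [C2v _ _] := hv.
have := wdivD (wdivD (wdiv_C2 a oO C2v Op p0) (wdivZ (- T) wc)) (wdivZ (- e) bh).
move=> /(wdiv_local_max p0) H.
have : div_weighted_grad a v p + - T * c + - e * ch <= 0.
  apply: H; near=> q.
  have Oq : Omega q by near: q; exact: open_nbhs_nbhs.
  have psiq : psi q <= w q by near: q; exact: nw.
  have := Wmax _ Oq; rewrite /W wp.
  have : T * psi q <= T * w q by rewrite ler_wpM2l.
  by rewrite /h !mulNr; lra.
(* The sign of [b] enters here: where [v >= 0], [b * v <= 0] and [v] has nonnegative weighted
   divergence. *)
have vp : 0 <= v p by have := psi_ge0 _ Sp; have := WE p; lra.
have : b p * v p <= 0 by rewrite mulr_le0_ge0// hb.
have := hdiv Op; have : 0 <= - T * c by rewrite mulNr oppr_ge0 mulr_ge0_le0.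
have : 0 < - e * ch by rewrite mulNr oppr_gt0 pmulr_rlt0.
by lra.
Unshelve. all: by end_near. Qed.

Lemma maximum_principle p : Omega p -> v p <= 0.
Proof.
have [pos|npos] := pselect (exists2 q, bd0 Omega q & 0 < v q); last first.
  move=> Op; have := @le_from_bottom 0 (lexx 0) _ p Op; rewrite mul0r; apply.
  move=> q bq; rewrite mul0r leNgt; apply/negP => vq.
  by apply: npos; exists q.
move=> _; exfalso; have [q bq vq] := pos.
have SB r : bd0 Omega r -> S r by move=> /bd0_O[Or r0]; split; rewrite ?r0.
have psi_gt0 r : S r -> 0 < psi r by move=> /psi_ge; exact: lt_le_trans.
have pq := psi_ge (SB _ bq); have pq0 := psi_gt0 _ (SB _ bq).
(* Where [v < c] on the bottom, [v / psi < c / c0], half the ratio at [q]; the supremum of the ratio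
   is therefore decided on [v >= c], a set bounded by the limsup condition. *)
pose c := v q / psi q * c0 / 2.
have c_gt0 : 0 < c by rewrite /c !mulr_gt0// ?invr_gt0.
have cE : c * 2 = v q / psi q * c0 by rewrite /c; field; rewrite gt_eqF.
have [r0 Hr0] := limsup_at_infty_lt c_gt0 hlimsup.
(* [bd0 Omega] itself need not be closed. This description is visibly closed, and the sign of [v] on
   [bdL] places it inside [bd0 Omega]. *)
pose F := (closure Omega `&` [set p | c <= v p]) `&` [set p : 'rV[R]_n * R | 0 <= - p.2].
have FB p' : F p' -> bd0 Omega p'.
  move=> [[cp /= cv]]; rewrite oppr_ge0 => p0.
  have [/Ogt0|//] := positive_closure cp (lt_le_trans c_gt0 cv).
  by rewrite ltNge p0.
have closedF : closed F.
  apply: closed_within_ge.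
    by apply: closed_within_ge; [exact: closed_closure|exact: closure_Omega_cont].
  apply: continuous_subspaceT => p'; apply: (@cvgN _ _ _ (nbhs p')).
  exact: cvg_snd.
have compF : compact F.
  apply: (subclosed_compact closedF (@compact_cylinder R n 0 (`|r0| ^+ 2) 0)).
  move=> p' Fp; have bp := FB _ Fp; have [_ p0] := bd0_O bp.
  split => /=; last by rewrite p0 lexx.
  rewrite subr0 -sqr_enorm ler_sqr ?nnegrE ?enorm_ge0//.
  apply: le_trans (ler_norm r0); rewrite leNgt; apply/negP => /(Hr0 _ bp).
  by case: Fp => [[_ /=]]; rewrite leNgt => /negP.
have Fq : F q.
  split => /=; last by have [_ ->] := bd0_O bq; rewrite oppr0.
  split => /=; first by case: bq => -[].
  have : v q / psi q * c0 <= v q.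
    by rewrite mulrAC ler_pdivrMr// ler_pM2l.
  by lra.
have cF : {within F, continuous (fun p => v p / psi p)}.
  apply: within_continuousM.
    by apply: (continuous_subspaceW _ closure_Omega_cont) => p' [[]].
  apply: within_continuousV => [p' /FB/SB/psi_gt0/lt0r_neq0//|].
  by apply: (continuous_subspaceW _ psi_cont) => p' /FB/SB.
have [p0 Fp0 pmax] := compact_EVT_max (ex_intro _ _ Fq) compF cF.
rewrite inE in Fp0; have bp0 := FB _ Fp0; have Sp0 := SB _ bp0.
pose T := v p0 / psi p0.
have qT : v q / psi q <= T by apply: pmax; rewrite inE.
have T0 : 0 < T by apply: lt_le_trans qT; rewrite divr_gt0.
have vT p' : Omega p' -> v p' <= T * psi p'.
  apply: le_from_bottom; first exact: ltW.
  move=> p'' bp''; have Sp'' := SB _ bp''.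
  have [cv|vc] := leP c (v p'').
    rewrite -ler_pdivrMr ?psi_gt0//; apply: pmax; rewrite inE; split => /=.
      by split => //; case: bp'' => -[].
    by have [_ ->] := bd0_O bp''; rewrite oppr0.
  apply: le_trans (ltW vc) _; apply: le_trans (_ : v q / psi q * c0 <= _).
    by rewrite -cE; lra.
  by apply: ler_pM => //; [rewrite divr_ge0// ltW|exact: ltW|exact: psi_ge].
have [Op0 p02] := bd0_O bp0.
have vp0 : v p0 = T * psi p0 by rewrite /T divfK// gt_eqF// psi_gt0.
clearbody T; case: p0 p02 bp0 Op0 vp0 {Fp0 pmax Sp0} => x l /= -> bp0 Ox vp0.
have [w [k [rw kV wx nw]]] := psi_bottom Ox.
have [_ /= nO] := bd0_ray oO Ogt0 bp0.
have rv := rayD (ray_classical hv nO) (rayZ (- T) rw).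
have : 0 <= conormal a v x + - T * k.
  apply: (ray_max rv); near=> s.
  have Os : Omega (x, s) by near: s; exact: nO.
  have psis : psi (x, s) <= w (x, s) by near: s; exact: nw.
  rewrite wx mulNr vp0 mulNr subrr subr_le0.
  by apply: le_trans (vT _ Os) _; rewrite ler_pM2l.
rewrite -(pmulr_rge0 _ d0) => con.
have := hL bp0; rewrite vp0.
by have := mulr_gt0 T0 (_ : 0 < d * k - V x * psi (x, 0)); rewrite subr_gt0 => /(_ kV); lra.
Unshelve. all: by end_near. Qed.

End MaximumPrinciple.

(** * The supersolution near the Simons cone *)

Section NearCone.
Context {R : realType} {m : nat} (g a A B j : R).
Hypotheses (g01 : 0 < g < 1) (aE : a = 1 - 2 * g) (j0 : 0 < j)
  (jE : j ^+ 2 = 4 * B * (1 + a))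
  (AB : forall l, 0 <= l -> 3 / 4 <= profile g A B l).

(** A parabola rising from 1 at the cone to its vertex value 2 at [z = 1 / j]. *)
Definition concave_cap (z : R) : R := 1 + 2 * j * z + (- j ^+ 2) * z ^+ 2.

Lemma concave_capE z : concave_cap z = 2 - (1 - j * z) ^+ 2.
Proof. by rewrite /concave_cap; ring. Qed.

(** The second derivative [- 2 * j ^ 2], a gradient of norm at least 1 and a profile of at least 3/4
    give at most [- 3 / 2 * j ^ 2 * l ^ a]. The vertical part is at most [2 * (2 * B * (1 + a)) * l
    ^ a = j ^ 2 * l ^ a]. *)
Lemma concave_cap_wdiv (x : 'rV[R]_(m + m)) l : calO x -> 0 < l ->
  conefun simons x <= j^-1 -> exists2 c, c <= 0 &
  wdiv a (fun q => concave_cap (conefun simons q.1) * profile g A B q.2) (x, l) c.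
Proof.
move=> xO l0 xj; have [y0 q0 qy] := calO_diagq xO.
have [dX [eX [Xd Xs Xg]]] := conefun_xder2 (@simons2 R m) sum_simons y0 q0 qy.
have [dG Gd] := profile_wder2 aE A B l0.
set z := conefun simons x in xj.
have Xd' : xder2 (fun x => concave_cap (conefun simons x)) x
    (fun i => (2 * j - 2 * j ^+ 2 * z) * dX i)
    (fun i => (2 * j - 2 * j ^+ 2 * z) * eX i + (- 2 * j ^+ 2) * dX i ^+ 2).
  move=> i; set G := fun s => conefun simons (x + s *: delta_mx 0 i).
  have G0 : G 0 = z by rewrite /G scale0r addr0.
  have d1 : \forall y \near G 0, is_derive (y : R) 1 concave_cap (2 * j + 2 * (- j ^+ 2) * y).
    by near=> y; exact: is_derive_quad.
  have d2 : is_derive (G 0) 1 (fun y : R => 2 * j + 2 * (- j ^+ 2) * y) (2 * - j ^+ 2).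
    exact: is_derive_affine.
  have := wder2_comp (Xd i) d1 d2.
  by move/wder2_eq; apply; rewrite /= !scale0r !addr0 -/z; ring.
have jz : 0 <= 2 * j - 2 * j ^+ 2 * z.
  have : j * z <= 1 by rewrite mulrC -ler_pdivlMr// div1r.
  by move=> H; have := ltW j0; nra.
have wX := wdiv_sep Xd' Gd.
eexists; last exact: wX.
rewrite big_split /= -!mulr_sumr concave_capE -/z.
have la : 0 < l `^ a by rewrite powR_gt0.
have := AB (ltW l0); set G := profile g A B l => GB.
set E := \sum_(i < _) eX i in Xs *; set D := \sum_(i < _) dX i ^+ 2 in Xg *.
have H1 : (2 * j - 2 * j ^+ 2 * z) * E <= 0 by rewrite mulr_ge0_le0.
have j2 : 0 < j ^+ 2 by rewrite exprn_gt0.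
have H2 : j ^+ 2 <= j ^+ 2 * D by rewrite ler_peMr// ltW.
have H3 : (2 - (1 - j * z) ^+ 2) * (2 * B * (1 + a) * l `^ a) <= j ^+ 2 * l `^ a.
  rewrite (_ : 2 * B * (1 + a) * l `^ a = 2^-1 * j ^+ 2 * l `^ a); last first.
    by rewrite jE; field.
  rewrite mulrA ler_pM2r// mulrA; apply: ler_piMl; first exact: ltW.
  by have := sqr_ge0 (1 - j * z); lra.
have H4 : l `^ a * G * ((2 * j - 2 * j ^+ 2 * z) * E + - 2 * j ^+ 2 * D)
    <= l `^ a * (3 / 4 * (- 2 * j ^+ 2)).
  rewrite -mulrA ler_pM2l//.
  have : (2 * j - 2 * j ^+ 2 * z) * E + - 2 * j ^+ 2 * D <= - 2 * j ^+ 2 by lra.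
  set Y := _ + _; move=> HY.
  by nra.
have : 0 < j ^+ 2 * l `^ a by rewrite mulr_gt0.
by lra.
Unshelve. all: by end_near. Qed.

Lemma conefun_continuous (x : 'rV[R]_(m + m)) : calO x ->
  {for x, continuous (@conefun R _ simons)}.
Proof.
move=> /calO_diagq[y0 _ _]; apply: (@cvgM _ _ (nbhs x)).
  exact: diagq_continuous.
apply: (@continuous_comp _ _ _ (diagq (cst 1)) (@powR R ^~ (- 2^-1))).
  exact: diagq_continuous.
apply: differentiable_continuous; apply/derivable1_diffP.
by apply: derivable_powR; rewrite in_itv /= y0.
Qed.

Lemma conefun_ge0 (x : 'rV[R]_(m + m)) : calO x -> 0 <= conefun simons x.
Proof. by move=> /calO_diagq[_ q0 _]; rewrite mulr_ge0// powR_ge0. Qed.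

Definition collar (p : 'rV[R]_(m + m) * R) : R :=
  concave_cap (conefun simons p.1) * profile g A B p.2.

(** The inner minimum freezes the parabola at its vertex. There the product is at least
    [2 * (3 / 4) = 3 / 2], so the outer minimum is already the constant and the freezing leaves no
    trace. *)
Definition collar_min (p : 'rV[R]_(m + m) * R) : R :=
  Num.min (concave_cap (Num.min (conefun simons p.1) j^-1) * profile g A B p.2)
    (3 / 2).

Lemma collar_min_le p : collar_min p <= 3 / 2.
Proof. by rewrite /collar_min ge_min lexx orbT. Qed.

Lemma collar_min_le_collar p : conefun simons p.1 <= j^-1 ->
  collar_min p <= collar p.
Proof. by move=> zj; rewrite /collar_min [X in concave_cap X]min_l// ge_min lexx. Qed.

Lemma concave_cap_ge1 z : 0 <= z -> z <= j^-1 -> 1 <= concave_cap z.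
Proof.
move=> z0 zj; have H : j * z <= 1 by rewrite mulrC -ler_pdivlMr// div1r.
have jz : 0 <= j * z by rewrite mulr_ge0// ltW.
by rewrite concave_capE; nra.
Qed.

Lemma collar_min_ge p : calO p.1 -> 0 <= p.2 -> 3 / 4 <= collar_min p.
Proof.
move=> pO p0; rewrite le_min; apply/andP; split; last by lra.
have z0 : 0 <= Num.min (conefun simons p.1) j^-1.
  by rewrite le_min conefun_ge0//= invr_ge0 ltW.
have := concave_cap_ge1 z0 (_ : _ <= j^-1); rewrite ge_min lexx orbT => /(_ isT).
by have := AB p0; set X := concave_cap _; nra.
Qed.

Lemma collar_min_cases p : calO p.1 -> 0 <= p.2 ->
  collar_min p = 3 / 2 \/ conefun simons p.1 < j^-1 /\ collar_min p = collar p.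
Proof.
move=> pO p0; have [zj|jz] := ltP (conefun simons p.1) j^-1; last first.
  left; rewrite /collar_min min_r//; rewrite min_r//.
  have := AB p0; rewrite concave_capE divff ?gt_eqF// subrr expr0n subr0.
  by lra.
rewrite /collar_min [X in concave_cap X]min_l ?ltW// -/(collar p).
by rewrite minEle; case: ifP => _; [right|left].
Qed.

(** On the bottom the profile is 1, and the parabola is below 3/2 as long as [j * z < 1 / 4]; since
    [z <= 2 * (s - t)], the constant branch starts only at a fixed distance from the cone. *)
Lemma collar_min_top (x : 'rV[R]_(m + m)) : calO x -> collar_min (x, 0) = 3 / 2 ->
  j^-1 / 8 <= srad x - trad x.
Proof.
move=> xO c32; rewrite leNgt; apply/negP => st.
have z_lt : conefun simons x < j^-1 / 4 by have := conefun_le xO; lra.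
have jV : 0 < j^-1 by rewrite invr_gt0.
have zj : conefun simons x <= j^-1 by lra.
have : collar_min (x, 0) <= collar (x, 0) by exact: collar_min_le_collar.
rewrite c32 /collar /= (profile0 g01) mulr1 concave_capE.
have jz : 0 <= j * conefun simons x by rewrite mulr_ge0 ?conefun_ge0// ltW.
have jz4 : j * conefun simons x < 4^-1.
  have : j * conefun simons x < j * (j^-1 / 4) by rewrite ltr_pM2l.
  by rewrite (_ : j * (j^-1 / 4) = 4^-1)//; field; rewrite gt_eqF.
by set y := j * _ in jz jz4 *; nra.
Qed.

Lemma collar_min_continuous : {within [set p | calO p.1 /\ 0 <= p.2],
  continuous collar_min}.
Proof.
have /andP[g0 _] := g01.
have cz : {within [set p : 'rV[R]_(m + m) * R | calO p.1 /\ 0 <= p.2],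
    continuous (fun p => conefun simons p.1)}.
  by apply: continuous_fst_within => q [qO _]; exact: conefun_continuous.
apply: within_continuous_min; last exact: within_continuous_cst.
apply: within_continuousM; last first.
  by apply: (continuous_subspaceW _ (continuous_profile_chalf g0)) => q [].
have cm := within_continuous_min cz (@within_continuous_cst _ _ _ j^-1).
apply: within_continuousD.
  apply: within_continuousD; first exact: within_continuous_cst.
  by apply: within_continuousM; first exact: within_continuous_cst.
apply: within_continuousM; first exact: within_continuous_cst.
exact: (within_continuousM cm cm).
Qed.

End NearCone.

(** * Choice of constants and assembly of the supersolution *)

Theorem proposition1p4 (R : realType) (gamma a d alpha : R) (m : nat)
  (f : R -> R) (u v b : 'rV[R]_(m + m) * R -> R)
  (Omega : set ('rV[R]_(m + m) * R))
  (hgamma : 0 < gamma < 1) (ha : a = 1 - 2 * gamma)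
  (hd : extension_constant gamma d)
  (hm : (1 <= m)%N)
  (halpha : 0 < alpha < 1) (hf : C2alpha alpha f)
  (hfodd : forall x, x \in `]-1, 1[ -> f (- x) = - f x)
  (hf0 : f 0 = 0)
  (* the value at 1 of the continuous extension of f *)
  (hf1 : f x @[x --> 1^'-] --> (0 : R))
  (hf2 : forall x, x \in `]0, 1[ -> derive1n 2 f x < 0)
  (hu : saddle_shaped_solution a d f u)
  (hOmega : open Omega)
  (hOmegaO : Omega `<=` [set p | calO p.1 /\ 0 < p.2])
  (hOmega0 : bd0 Omega !=set0)
  (hv : classical_reg a Omega v)
  (hvub : has_ubound (v @` Omega))
  (hb : forall p, Omega p -> b p <= 0)
  (hdiv : forall p, Omega p -> - div_weighted_grad a v p <= b p * v p)
  (hL : forall x, bd0 Omega (x, 0) -> linearized a d f u v x <= 0)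
  (hbdL : forall p, bdL Omega p -> v p <= 0)
  (hlimsup : (limsup_at_infty (bd0 Omega) v <= 0)%E) :
  forall p, Omega p -> v p <= 0.
Proof.
have /andP[g0 g1] := hgamma.
have [df _] := hf; have [d0 _] := hd.
have [sol ub _ u_gt0] := hu.
have u_lt1 x l : 0 <= l -> u (x, l) < 1.
  by move=> l0; apply: le_lt_trans (ler_norm _) (ub x l l0).
pose mu := derive1 f 0.
have mu0 : 0 < mu := derive1_0_gt0 df hf0 hf1 hf2.
have [s0 /andP[s0_gt0 _] half] := half_slope df hf0 hf1 hf2.
pose A := mu / (2 * gamma * d).
have A0 : 0 < A by rewrite divr_gt0// !mulr_gt0.
have dA : d * (2 * gamma * A) = mu by rewrite /A; field; rewrite !gt_eqF.
have [B B0 AB] := profile_lower hgamma A0.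
have a1 : 0 < 1 + a by rewrite ha; lra.
pose j := Num.sqrt (4 * B * (1 + a)).
have j0 : 0 < j by rewrite sqrtr_gt0 !mulr_gt0.
have jE : j ^+ 2 = 4 * B * (1 + a) by rewrite sqr_sqrtr// !mulr_ge0// ltW.
have z0 : 0 < j^-1 / 8 by rewrite divr_gt0// invr_gt0.
have [e e0 uge] := away_from_cone hgamma ha d0 sol mu0 s0_gt0 half u_gt0 z0.
(* The bound is lowered below 1 so that the concavity gap at [e'] is defined and positive. *)
pose e' := Num.min e 2^-1.
have e'01 : 0 < e' < 1.
  by rewrite lt_min e0 /= invr_gt0 ltr0n /= gt_min orbC invf_lt1 ?ltr1n ?ltr0n.
pose gap := f e' - derive1 f e' * e'.
have gap0 : 0 < gap := concave_gap df hf0 hf2 e'01.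
(* Then [eta * (3 / 2) * mu] is half the gap, so the constant branch leaves a strict surplus on the
   bottom. *)
pose eta := gap / (3 * mu).
have eta0 : 0 < eta by rewrite divr_gt0// mulr_gt0.
have etaE : eta * (3 / 2) * mu = gap / 2 by rewrite /eta; field; rewrite gt_eqF.
pose psi p := u p + eta * collar_min gamma A B j p.
have fmu x : calO x -> derive1 f (u (x, 0)) <= mu.
  by move=> xO; apply: (derive1_le0 df hf2); rewrite u_gt0//= u_lt1.
have psi_cont : {within [set p | calO p.1 /\ 0 <= p.2], continuous psi}.
  apply: within_continuousD.
    by apply: (continuous_subspaceW _ (solution_continuous sol)) => q [].
  apply: within_continuousM; first exact: within_continuous_cst.
  exact: collar_min_continuous hgamma.
have c0 : 0 < eta * (3 / 4) by rewrite mulr_gt0.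
apply: (@maximum_principle R (m + m) gamma a d (fun x => derive1 f (u (x, 0)))
  (@calO R m) psi v b (eta * (3 / 4)) Omega hgamma ha d0) => //.
- move=> [x l] [/= xO l0]; apply: ler_wpDl; first exact/ltW/u_gt0.
  by rewrite ler_pM2l//; apply: (collar_min_ge _ AB).
- move=> [x l] /= xO l0; have ul := solution_wdiv sol (l0 : 0 < (x, l).2).
  have [c32|[zj cE]] := collar_min_cases j0 AB (xO : calO (x, l).1) (ltW l0).
    exists (fun p => u p + eta * (3 / 2)), (0 + 0); split.
    + exact: (wdivD ul (wdiv_cst _ _ _)).
    + by rewrite addr0.
    + by rewrite /psi c32.
    + by near=> q; rewrite lerD2l ler_pM2l// collar_min_le.
  have [c c_le0 cw] := concave_cap_wdiv ha j0 jE AB xO l0 (ltW zj).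
  exists (fun p => u p + eta * collar gamma A B j p), (0 + eta * c); split.
  + exact: (wdivD ul (wdivZ eta cw)).
  + by rewrite add0r mulr_ge0_le0// ltW.
  + by rewrite /psi cE.
  have nz : \forall q \near (x, l), conefun simons q.1 < j^-1.
    have nx : \forall y \near x, conefun simons y < j^-1.
      exact: (cvgr_lt _ (conefun_continuous xO)).
    near=> q; suff [] : conefun simons q.1 < j^-1 /\ True by [].
    near: q; exact: (@near_fst_snd R _ (fun y => conefun simons y < j^-1)
      (fun=> True) x l nx filterT).
  near=> q; rewrite lerD2l ler_pM2l//; apply: collar_min_le_collar.
  by apply: ltW; near: q; exact: nz.
- move=> x xO; have rx := solution_ray sol x; have [_ _ fE] := sol.
  have ux0 : 0 < u (x, 0) by exact: u_gt0.
  have ux01 : 0 < u (x, 0) < 1 by rewrite ux0 u_lt1.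
  have fx := fmu _ xO.
  (* On the constant branch [u >= e'], and the gap pays for [f'(u) * eta * 3 / 2]. On the other
     branch the conormal derivative of the collar supplies [mu] times its value, and the pointwise
     gap at [u] gives strictness. *)
  have [c32|[zj cE]] := collar_min_cases j0 AB (xO : calO (x, 0 : R).1) (lexx 0).
    exists (fun p => u p + eta * (3 / 2)), (conormal a u x + 0); split.
    + exact: (rayD rx (ray_cst _ _ _)).
    + rewrite addr0 fE /psi c32.
      have ue : e <= u (x, 0).
        by apply: uge; exact: collar_min_top c32.
      have e'u : e' <= u (x, 0) by rewrite ge_min ue.
      have := concave_gap_incr df hf2 (proj1 (andP e'01)) e'u (proj2 (andP ux01)).
      rewrite -/gap => H.
      have : derive1 f (u (x, 0)) * (eta * (3 / 2)) <= mu * (eta * (3 / 2)).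
        by rewrite ler_pM2r// mulr_gt0.
      by lra.
    + by rewrite /psi c32.
    + by near=> s; rewrite lerD2l ler_pM2l// collar_min_le.
  exists (fun p => u p + eta * collar gamma A B j p),
    (conormal a u x + eta * (concave_cap j (conefun simons x) * (2 * gamma * A))); split.
  + exact: (rayD rx (rayZ eta (ray_profile
      (fun y => concave_cap j (conefun simons y)) A B x hgamma ha))).
  + rewrite [ltRHS]mulrDr fE /psi cE /collar /= (profile0 hgamma) mulr1.
    set X := concave_cap _ _.
    have X0 : 0 < X.
      apply: lt_le_trans ltr01 _; apply: concave_cap_ge1 => //; last exact: ltW.
      exact: conefun_ge0.
    have := concave_gap df hf0 hf2 ux01.
    have -> : d * (eta * (X * (2 * gamma * A))) = eta * X * mu by rewrite -dA; ring.
    have : derive1 f (u (x, 0)) * (eta * X) <= mu * (eta * X).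
      by rewrite ler_pM2r// mulr_gt0.
    by lra.
  + by rewrite /psi cE.
  + near=> s; rewrite lerD2l ler_pM2l//; apply: collar_min_le_collar.
    exact: ltW.
Unshelve. all: by end_near. Qed.
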